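(* Let $F$ be a closed smooth connected surface, and let $\rho:\mathbb Z^2\to \mathrm{Diff}(F)$ be a smooth action. Assume that there exists a point $x_0\in F$ fixed by every element of $\rho(\mathbb Z^2)$. Let $\rho_*:\mathbb Z^2\to \mathrm{Aut}(\pi_1(F,x_0))$ denote the induced action on the fundamental group. Then there exist a closed smooth $4$-manifold $M$, a closed embedded surface $K\subset M$ diffeomorphic to $F$, and a smooth map $f:M\to T^2$ such that: (i) $f(K)$ consists of one point; (ii) $f$ is a submersion on $M\setminus K$; (iii) $\pi_1(M)\cong \pi_1(F,x_0)\rtimes_{\rho_*}\mathbb Z^2$. Moreover, $M$ may be chosen to be the total space of the flat surface bundle over $T^2$ associated to $\rho$, and $f$ may be chosen to agree with the bundle projection outside a trivialized neighborhood of one fiber.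
   Context: $\mathrm{Diff}(F)$ is the group of smooth diffeomorphisms of $F$ under composition. $T^2=\mathbb R^2/\mathbb Z^2$. The flat surface bundle over $T^2$ associated to $\rho$ has total space $(\mathbb R^2\times F)/\mathbb Z^2$, where $v\in\mathbb Z^2$ acts by $v\cdot(u,x)=(u+v,\rho(v)(x))$, and its projection to $T^2$ is induced by projection to the first factor. For a group $H$ and an action $\phi:\mathbb Z^2\to\mathrm{Aut}(H)$, the semidirect product $H\rtimes_\phi\mathbb Z^2$ is the set $H\times\mathbb Z^2$ with multiplication $(h,v)(h',v')=(h\,\phi(v)(h'),v+v')$. A trivialized neighborhood of a fiber is the preimage of a closed disk $D\subset T^2$ under the bundle projection, with a bundle trivialization over $D$. *)

(* Defs.v *)
From HB Require Import structures.
From mathcomp Require Import all_boot all_order all_algebra generic_quotient.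
From mathcomp Require Import all_classical all_reals all_analysis.
From mathcomp Require Import continuous_path.
Import Order.TTheory GRing.Theory Num.Theory.
Import numFieldNormedType.Exports.

Set Implicit Arguments.
Unset Strict Implicit.
Unset Printing Implicit Defensive.

Local Open Scope classical_set_scope.
Local Open Scope ring_scope.
Local Open Scope quotient_scope.

Section SmoothMaps.
Variable R : realType.

Fixpoint Ck (n m k : nat) (U : set 'rV[R]_n) (f : 'rV[R]_n -> 'rV[R]_m) :
    Prop :=
  match k with
  | 0 => forall x, U x -> {for x, continuous f}
  | k'.+1 => (forall x, U x -> differentiable f x) /\
             forall v, Ck k' U (fun x => 'd f x v)
  end.

(* Meaningful for open U only. *)
Definition Cinfty (n m : nat) (U : set 'rV[R]_n)
  (f : 'rV[R]_n -> 'rV[R]_m) := forall k, Ck k U f.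

End SmoothMaps.

(* cmap is relevant on cdom only, and cinv on the image of cdom only: outside,
   both take arbitrary values. *)
Record chart (R : realType) (n : nat) (X : topologicalType) := Chart {
  cdom : set X;
  cmap :> X -> 'rV[R]_n;
  cinv : 'rV[R]_n -> X;
  cdom_open : open cdom;
  crange_open : open (cmap @` cdom);
  cmapK : forall x, cdom x -> cinv (cmap x) = x;
  cmap_cts : forall x, cdom x -> {for x, continuous cmap};
  cinv_cts : forall u, (cmap @` cdom) u -> {for u, continuous cinv} }.

Section Manifolds.
Variable R : realType.

Definition chart_compatible (n : nat) (X : topologicalType)
    (c d : chart R n X) :=
  Cinfty (c @` (cdom c `&` cdom d)) (d \o cinv c) /\
  Cinfty (d @` (cdom c `&` cdom d)) (c \o cinv d).

(* Atlases need not be maximal. *)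
Definition smooth_atlas (n : nat) (X : topologicalType)
    (A : set (chart R n X)) :=
  (forall x, exists2 c, A c & cdom c x) /\
  (forall c d, A c -> A d -> chart_compatible c d).

Definition smooth_chart (n : nat) (X : topologicalType)
    (A : set (chart R n X)) (c : chart R n X) :=
  forall d, A d -> chart_compatible c d.

Definition smooth_manifold (n : nat) (X : topologicalType)
    (A : set (chart R n X)) :=
  [/\ hausdorff_space X, @second_countable X & smooth_atlas A].

Definition closed_manifold (n : nat) (X : topologicalType)
    (A : set (chart R n X)) :=
  smooth_manifold A /\ compact [set: X].

Section Maps.
Variables (n m : nat) (X Y : topologicalType).
Variables (A : set (chart R n X)) (B : set (chart R m Y)).

(* Meaningful for open U only. *)
Definition smooth_on (U : set X) (f : X -> Y) :=
  (forall x, U x -> {for x, continuous f}) /\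
  (forall c d, A c -> B d ->
    Cinfty (c @` (U `&` cdom c `&` f @^-1` cdom d)) (d \o f \o cinv c)).

Definition smooth (f : X -> Y) := smooth_on setT f.

(* Smoothness on an arbitrary subset: existence of local smooth extensions. *)
Definition smooth_within (S : set X) (f : X -> Y) :=
  forall x, S x -> exists (U : set X) (g : X -> Y),
    [/\ open U, U x, smooth_on U g & forall y, S y -> U y -> g y = f y].

Definition submersion_at (f : X -> Y) (x : X) :=
  forall c d, A c -> B d -> cdom c x -> cdom d (f x) ->
  forall w, exists v, 'd (d \o f \o cinv c : 'rV[R]_n -> 'rV[R]_m) (c x) v = w.

End Maps.

Definition diffeomorphism (n m : nat) (X Y : topologicalType)
    (A : set (chart R n X)) (B : set (chart R m Y)) (f : X -> Y) :=
  smooth A B f /\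
  exists g, [/\ smooth B A g, cancel f g & cancel g f].

Lemma diffeomorphism_continuous (n m : nat) (X Y : topologicalType)
    (A : set (chart R n X)) (B : set (chart R m Y)) (f : X -> Y) :
  diffeomorphism A B f -> continuous f.
Proof. by move=> [[cf _] _] x; exact: cf. Qed.

Definition space_atlas (n : nat) : set (chart R n 'rV[R]_n) :=
  [set c | cdom c = setT /\ forall u, c u = u].

Definition prod_atlas (n m : nat) (X Y : topologicalType)
    (A : set (chart R n X)) (B : set (chart R m Y)) :
    set (chart R (n + m) (X * Y)%type) :=
  [set e | exists c d, [/\ A c, B d, cdom e = cdom c `*` cdom d
    & forall p, cdom e p -> e p = row_mx (c p.1) (d p.2)]].

(* The charts induced by q from restrictions of charts of X to open sets on
   which q is injective; when q is a covering map by a group of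
   diffeomorphisms, this is the smooth structure making q a local
   diffeomorphism. *)
Definition quotient_atlas (n : nat) (X Y : topologicalType)
    (A : set (chart R n X)) (q : X -> Y) : set (chart R n Y) :=
  [set e | exists c W, [/\ A c /\ open W, W `<=` cdom c,
    (forall x y, W x -> W y -> q x = q y -> x = y),
    cdom e = q @` W & forall x, W x -> e (q x) = c x]].

Section Submanifolds.
Variables (l k : nat) (X : topologicalType).
Variables (A : set (chart R (l + k) X)) (K : set X).

Definition slice_chart (c : chart R (l + k) X) :=
  smooth_chart A c /\ forall x, cdom c x -> (K x <-> lsubmx (c x) = 0).

Definition embedded_submanifold :=
  forall x, K x -> exists2 c, slice_chart c & cdom c x.

Definition submanifold_atlas : set (chart R k (set_type K)) :=
  [set e | exists c, [/\ slice_chart c, cdom e = set_val @^-1` cdom c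
    & forall x, cdom e x -> e x = rsubmx (c (set_val x))]].

End Submanifolds.

Definition closed_disk (Y : topologicalType) (B : set (chart R 2 Y))
    (D : set Y) :=
  exists (d : chart R 2 Y) (a : 'rV[R]_2) (r : R),
    let disk := [set u : 'rV[R]_2 |
      \sum_(i < 2) (u 0 i - a 0 i) ^+ 2 <= r ^+ 2] in
    [/\ smooth_chart B d, 0 < r, disk `<=` d @` cdom d
      & D = cdom d `&` d @^-1` disk].

(* p @^-1` D is diffeomorphic to D `*` F over D, through Phi and its inverse
   e |-> (p e, Psi e). *)
Definition trivialized_over (nE nB nF : nat) (E B F : topologicalType)
    (AE : set (chart R nE E)) (AB : set (chart R nB B))
    (AF : set (chart R nF F)) (p : E -> B) (D : set B) :=
  exists (Phi : B * F -> E) (Psi : E -> F),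
    [/\ smooth_within (prod_atlas AB AF) AE (D `*` setT) Phi,
        smooth_within AE AF (p @^-1` D) Psi,
        (forall b x, D b -> p (Phi (b, x)) = b /\ Psi (Phi (b, x)) = x)
      & forall e, D (p e) -> Phi (p e, Psi e) = e].

End Manifolds.

Arguments space_atlas : clear implicits.

Record Z2action (X : Type) := Z2Action {
  act :> 'rV[int]_2 -> X -> X;
  act0 : forall x, act 0 x = x;
  actD : forall v w x, act (v + w) x = act v (act w x) }.

Section OrbitSpace.
Variables (X : topologicalType) (a : Z2action X).

Definition orbit_rel (x y : X) : bool := `[< exists v, a v x = y >].

Lemma orbit_rel_refl : reflexive orbit_rel.
Proof. by move=> x; apply/asboolP; exists 0; rewrite act0. Qed.

Lemma orbit_rel_sym : symmetric orbit_rel.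
Proof.
have H x y : orbit_rel x y -> orbit_rel y x.
  move=> /asboolP[v <-]; apply/asboolP; exists (- v).
  by rewrite -actD addNr act0.
by move=> x y; apply/idP/idP; exact: H.
Qed.

Lemma orbit_rel_trans : transitive orbit_rel.
Proof.
move=> y x z /asboolP[v <-] /asboolP[w <-]; apply/asboolP; exists (w + v).
by rewrite actD.
Qed.

Definition orbit_equiv :=
  EquivRel orbit_rel orbit_rel_refl orbit_rel_sym orbit_rel_trans.

Definition orbit_space : topologicalType :=
  quotient_topology {eq_quot orbit_equiv}.

Definition orbit_pi (x : X) : orbit_space :=
  \pi_(quotient_topology {eq_quot orbit_equiv}) x.

Definition orbit_repr (y : orbit_space) : X :=
  repr (y : quotient_topology {eq_quot orbit_equiv}).

End OrbitSpace.

Section FlatBundle.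
Variable R : realType.

Definition Z2_to_R2 (v : 'rV[int]_2) : 'rV[R]_2 :=
  map_mx (fun k : int => k%:~R) v.

Lemma Z2_to_R2_0 : Z2_to_R2 0 = 0.
Proof. by apply/rowP => i; rewrite !mxE. Qed.

Lemma Z2_to_R2_D v w : Z2_to_R2 (v + w) = Z2_to_R2 v + Z2_to_R2 w.
Proof. by apply/rowP => i; rewrite !mxE intrD. Qed.

Definition translate (v : 'rV[int]_2) (u : 'rV[R]_2) : 'rV[R]_2 :=
  u + Z2_to_R2 v.

Lemma translate0 u : translate 0 u = u.
Proof. by rewrite /translate Z2_to_R2_0 addr0. Qed.

Lemma translateD v w u : translate (v + w) u = translate v (translate w u).
Proof. by rewrite /translate Z2_to_R2_D addrA addrAC. Qed.

Definition translation : Z2action 'rV[R]_2 := Z2Action translate0 translateD.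

Definition torus : topologicalType := orbit_space translation.

Definition torus_pi : 'rV[R]_2 -> torus := orbit_pi translation.

Definition torus_atlas : set (chart R 2 torus) :=
  quotient_atlas (space_atlas R 2) torus_pi.

Section Total.
Variables (F : topologicalType) (rho : Z2action F).

Definition diagonal (v : 'rV[int]_2) (p : 'rV[R]_2 * F) : 'rV[R]_2 * F :=
  (translate v p.1, rho v p.2).

Lemma diagonal0 p : diagonal 0 p = p.
Proof. by case: p => u x; rewrite /diagonal translate0 act0. Qed.

Lemma diagonalD v w p : diagonal (v + w) p = diagonal v (diagonal w p).
Proof. by rewrite /diagonal translateD actD. Qed.

Definition diagonal_action : Z2action ('rV[R]_2 * F)%type :=
  Z2Action diagonal0 diagonalD.

Definition flat_total : topologicalType := orbit_space diagonal_action.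

Definition flat_pi : 'rV[R]_2 * F -> flat_total := orbit_pi diagonal_action.

Definition flat_proj (e : flat_total) : torus := torus_pi (orbit_repr e).1.

Lemma flat_projE p : flat_proj (flat_pi p) = torus_pi p.1.
Proof.
have : flat_pi (orbit_repr (flat_pi p)) = flat_pi p by exact: reprK.
move=> /eqmodP /asboolP[v vE]; apply/eqmodP/asboolP; exists v.
exact: (congr1 fst vE).
Qed.

Definition flat_atlas (n : nat) (AF : set (chart R n F)) :
    set (chart R (2 + n) flat_total) :=
  quotient_atlas (prod_atlas (space_atlas R 2) AF) flat_pi.

End Total.
End FlatBundle.

Arguments torus_atlas : clear implicits.
Arguments flat_atlas {R F} rho {n} AF.
Arguments flat_proj R {F} rho e.

Section UnitInterval.
Variable R : realType.

Definition unit_interval : Type := set_type (`[0, 1]%classic : set R).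

HB.instance Definition _ := Topological.on unit_interval.

Definition clamp_fun (r : R) : R := Num.max 0 (Num.min 1 r).

Lemma clamp_subproof (r : R) : clamp_fun r \in (`[0, 1]%classic : set R).
Proof.
rewrite inE /= in_itv /= /clamp_fun le_max lexx /= ge_max ler01 /=.
by rewrite ge_min lexx.
Qed.

(* The nearest point of [0, 1]. *)
Definition clamp (r : R) : unit_interval :=
  @exist R (fun x => x \in (`[0, 1]%classic : set R)) _ (clamp_subproof r).

Definition ival (t : unit_interval) : R := set_val t.

Lemma ivalP t : 0 <= ival t <= 1.
Proof. by have := svalP t; rewrite inE /= in_itv. Qed.

Lemma clampK (r : R) : 0 <= r <= 1 -> ival (clamp r) = r.
Proof.
move=> /andP[r0 r1].
by rewrite /ival set_valE /= /clamp_fun (min_idPr r1) (max_idPr r0).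
Qed.

Lemma ivalK t : clamp (ival t) = t.
Proof. by apply: val_inj; apply: clampK; exact: ivalP. Qed.

Lemma ival_cts : continuous ival.
Proof. exact: initial_continuous. Qed.

Lemma clamp_cts : continuous clamp.
Proof.
apply: (@continuous_comp_initial _ _ _ set_val) => r.
apply: continuous_max; first exact: cst_continuous.
by apply: continuous_min; [exact: cst_continuous|exact: cvg_id].
Qed.

Lemma clamp01 : clamp 0 != clamp 1.
Proof.
apply/eqP => /(congr1 ival); rewrite !clampK ?lexx ?ler01//.
by move=> /eqP; rewrite eq_sym oner_eq0.
Qed.

HB.instance Definition _ := isBiPointed.Build unit_interval clamp01.

End UnitInterval.

Lemma pair_cts (X Y Z : topologicalType) (f : X -> Y) (g : X -> Z) :
  continuous f -> continuous g -> continuous (fun x => (f x, g x)).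
Proof. by move=> cf cg x; apply: cvg_pair; [exact: cf|exact: cg]. Qed.

Section Gluing.
Variables (R : realType) (X Y : topologicalType).

Lemma glue_cts (h : X -> R) (f g : X -> Y) :
  continuous h -> continuous f -> continuous g ->
  (forall x, h x = 2^-1 -> f x = g x) ->
  continuous (fun x => if h x <= 2^-1 then f x else g x).
Proof.
move=> ch cf cg fg; apply/continuous_subspace_setT.
have -> : [set: X] = h @^-1` [set r | r <= 2^-1] `|` h @^-1` [set r | 2^-1 <= r].
  by apply/seteqP; split => // x _ /=; have [|/ltW] := leP (h x) 2^-1; [left|right].
apply: withinU_continuous.
- by apply: preimage_closed => //; exact: closed_le.
- by apply: preimage_closed => //; exact: closed_ge.
- apply: (@subspace_eq_continuous _ _ _ f); last exact: continuous_subspaceT.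
  by move=> x /set_mem /= hx; rewrite /from_subspace /= hx.
- apply: (@subspace_eq_continuous _ _ _ g); last exact: continuous_subspaceT.
  move=> x /set_mem /= hx; rewrite /from_subspace /=; case: ifPn => // hx'.
  by apply/esym/fg/le_anti/andP.
Qed.

End Gluing.

Section FundamentalGroup.
Variables (R : realType) (X : topologicalType).
Local Notation I := (unit_interval R).

Lemma rescale_cts (c : R) :
  continuous (fun t : I => clamp (2 * ival t - c)).
Proof.
move=> t; apply: (@continuous_comp _ _ _ (fun t : I => 2 * ival t - c) (@clamp R)).
  apply: continuousB; last exact: cst_continuous.
  by apply: continuousM; [exact: cst_continuous|exact: ival_cts].
exact: clamp_cts.
Qed.

Section Concat.
Variables (x y z : X) (p : {path I from x to y}) (q : {path I from y to z}).

Definition concat_fun (t : I) : X :=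
  if ival t <= 2^-1 then p (clamp (2 * ival t)) else q (clamp (2 * ival t - 1)).

Lemma concat_cts : continuous concat_fun.
Proof.
apply: glue_cts.
- exact: ival_cts.
- move=> t.
  have -> : (fun t : I => p (clamp (2 * ival t))) =
      p \o (fun t : I => clamp (2 * ival t - 0)).
    by apply/funext => s /=; rewrite subr0.
  by apply: continuous_comp; [exact: rescale_cts|exact: cts_fun].
- move=> t.
  apply: (@continuous_comp _ _ _ (fun t : I => clamp (2 * ival t - 1)) q).
    exact: rescale_cts.
  exact: cts_fun.
- move=> t ->; rewrite divff ?pnatr_eq0// subrr.
  by rewrite [LHS]path_one [RHS]path_zero.
Qed.

Lemma concat_zero : concat_fun zero = x.
Proof.
rewrite /concat_fun /zero /= clampK ?lexx ?ler01//.
by rewrite invr_ge0 ler0n mulr0 [LHS]path_zero.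
Qed.

Lemma concat_one : concat_fun one = z.
Proof.
rewrite /concat_fun /one /= clampK ?lexx ?ler01//.
rewrite invf_ge1 ?ltr0n// lern1 /=.
rewrite mulr1 (_ : 2 - 1 = 1 :> R); last by rewrite -[2]/(1 + 1) addrK.
by rewrite [LHS]path_one.
Qed.

Definition concat : {path I from x to z} :=
  mk_path concat_cts concat_zero concat_one.

End Concat.

Section Homotopy.
Variables x y : X.
Implicit Types p q r : {path I from x to y}.

(* The first argument of H is the path parameter. *)
Definition path_homotopic p q : bool :=
  `[< exists H : I * I -> X, [/\ continuous H,
      forall t, H (t, zero) = p t /\ H (t, one) = q t
    & forall s, H (zero, s) = x /\ H (one, s) = y] >].

Lemma path_homotopic_refl : reflexive path_homotopic.
Proof.
move=> p; apply/asboolP; exists (fun ts => p ts.1); split => //.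
- move=> ts; apply: continuous_comp; first exact: cvg_fst.
  exact: cts_fun.
- by move=> s /=; rewrite path_zero path_one.
Qed.

Lemma path_homotopic_sym : symmetric path_homotopic.
Proof.
have sym p q : path_homotopic p q -> path_homotopic q p.
  move=> /asboolP[H [cH Hpq Hxy]]; apply/asboolP.
  have flip (s : R) (s01 : 0 <= s <= 1) :
      clamp (1 - ival (clamp s)) = clamp (1 - s) by rewrite clampK.
  exists (fun ts => H (ts.1, clamp (1 - ival ts.2))); split => //.
  - move=> ts; apply: (@continuous_comp _ _ _
      (fun ts : I * I => (ts.1, clamp (1 - ival ts.2))) H); last exact: cH.
    apply: pair_cts => [us|us]; first exact: cvg_fst.
    apply: (@continuous_comp _ _ _ snd (fun s : I => clamp (1 - ival s))).
      exact: cvg_snd.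
    apply: (@continuous_comp _ _ _ (fun s : I => 1 - ival s) (@clamp R)).
      by apply: continuousB; [exact: cst_continuous|exact: ival_cts].
    exact: clamp_cts.
  - move=> t /=; rewrite !flip ?lexx ?ler01// subr0 subrr.
    by have [] := Hpq t.
by move=> p q; apply/idP/idP; exact: sym.
Qed.

Lemma path_homotopic_trans : transitive path_homotopic.
Proof.
move=> q p r /asboolP[H [cH Hpq Hxy]] /asboolP[G [cG Gqr Gxy]].
have cresc (c : R) : continuous
    (fun ts : I * I => (ts.1, clamp (2 * ival ts.2 - c))).
  apply: pair_cts => ts; first exact: cvg_fst.
  apply: (@continuous_comp _ _ _ snd (fun s : I => clamp (2 * ival s - c))).
    exact: cvg_snd.
  exact: rescale_cts.
apply/asboolP; exists (fun ts => if ival ts.2 <= 2^-1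
  then H (ts.1, clamp (2 * ival ts.2 - 0))
  else G (ts.1, clamp (2 * ival ts.2 - 1))); split.
- apply: glue_cts.
  + move=> ts; apply: continuous_comp; first exact: cvg_snd.
    exact: ival_cts.
  + by move=> ts; apply: continuous_comp; [exact: cresc|exact: cH].
  + by move=> ts; apply: continuous_comp; [exact: cresc|exact: cG].
  + move=> [t s] /= ->; rewrite divff ?pnatr_eq0// subrr subr0.
    by rewrite (Hpq t).2 (Gqr t).1.
- move=> t /=; rewrite !clampK ?lexx ?ler01// invr_ge0 ler0n mulr0 subr0.
  rewrite (Hpq t).1 invf_ge1 ?ltr0n// lern1 /= mulr1.
  by rewrite (_ : 2 - 1 = 1 :> R) ?(Gqr t).2// -[2]/(1 + 1) addrK.
- by move=> s /=; case: ifP => _; rewrite ?(Hxy _).1 ?(Hxy _).2 ?(Gxy _).1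
    ?(Gxy _).2.
Qed.

Definition path_homotopic_equiv :=
  EquivRel path_homotopic path_homotopic_refl path_homotopic_sym
    path_homotopic_trans.

End Homotopy.

Definition pi1 (x : X) : Type := {eq_quot @path_homotopic_equiv x x}.

Definition pi1_class (x : X) (p : {path I from x to x}) : pi1 x :=
  \pi_({eq_quot @path_homotopic_equiv x x}) p.

Definition pi1_repr (x : X) (a : pi1 x) : {path I from x to x} :=
  repr (a : {eq_quot @path_homotopic_equiv x x}).

(* Path concatenation (first a, then b) respects homotopy, so the choice of
   representatives is immaterial. *)
Definition pi1_mul (x : X) (a b : pi1 x) : pi1 x :=
  pi1_class (concat (pi1_repr a) (pi1_repr b)).

End FundamentalGroup.

Section InducedMap.
Variables (R : realType) (X Y : topologicalType) (f : X -> Y) (x : X) (y : Y).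
Hypotheses (cf : continuous f) (fx : f x = y).
Local Notation I := (unit_interval R).

Section Path.
Variable p : {path I from x to x}.

Lemma comp_path_cts : continuous (f \o p).
Proof. by move=> t; apply: continuous_comp; [exact: cts_fun|exact: cf]. Qed.

Lemma comp_path_zero : (f \o p) zero = y.
Proof. by rewrite /= path_zero. Qed.

Lemma comp_path_one : (f \o p) one = y.
Proof. by rewrite /= path_one. Qed.

Definition comp_path : {path I from y to y} :=
  mk_path comp_path_cts comp_path_zero comp_path_one.

End Path.

Definition pi1_map (a : pi1 R x) : pi1 R y := pi1_class (comp_path (pi1_repr a)).

End InducedMap.

Definition semidirect_mul (H : Type) (mulH : H -> H -> H)
    (phi : 'rV[int]_2 -> H -> H) (a b : H * 'rV[int]_2) : H * 'rV[int]_2 :=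
  (mulH a.1 (phi a.2 b.1), a.2 + b.2).

(* Between two groups, a bijection preserving the product is a group
   isomorphism. *)
Definition mul_isomorphic (G H : Type) (mulG : G -> G -> G)
    (mulH : H -> H -> H) :=
  exists2 h : G -> H, bijective h & {morph h : a b / mulG a b >-> mulH a b}.

Section SurfaceCollapse.
Variables (R : realType) (F M : topologicalType).
Variables (AF : set (chart R 2 F)) (A : set (chart R 4 M)).

Definition closed_embedded_surface (K : set M) :=
  [/\ @embedded_submanifold R 2 2 M A K, compact K
    & exists h : F -> set_type K,
        diffeomorphism AF (@submanifold_atlas R 2 2 M A K) h].

Record surface_collapse (K : set M) (f : M -> torus R) : Prop := {
  collapse_manifold : closed_manifold A;
  collapse_surface : closed_embedded_surface K;
  collapse_smooth : smooth A (torus_atlas R) f;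
  collapse_point : exists b, f @` K = [set b];
  collapse_submersion : forall x, ~ K x -> submersion_at A (torus_atlas R) f x
}.

End SurfaceCollapse.

(* Main.v *)
(* The bundle projection itself is a submersion everywhere, so f can be the
   projection and K the fiber over the origin, which the slice u = 0 of
   'rV[R]_2 * F parametrizes. The quotient map 'rV[R]_2 * F -> M is open and
   injective on pieces of diameter less than 1 in the first factor, which gives
   the charts, the trivialization over a small disk and the separation
   properties of M. For the fundamental group, a map from the square to M is
   lifted by first lifting its projection to the torus coordinate by
   coordinate, as a continuous choice of angles; the component in F is then
   determined and continuous. A loop at [0, x0] thus lifts to a pair formed of
   a path from 0 to some v in Z^2, which is homotopic to the segment, and of a
   loop at x0. The second of two concatenated loops is lifted from (v, x0), and
   translating its lift back to (0, x0) applies rho v, whence the semidirect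
   product. *)

From HB Require Import structures.
Require Import Defs.
From mathcomp Require Import all_boot all_order all_algebra generic_quotient.
From mathcomp Require Import all_classical all_reals all_analysis.
From mathcomp Require Import continuous_path ring lra.
Import Order.TTheory GRing.Theory Num.Theory.
Import numFieldNormedType.Exports.

Set Implicit Arguments.
Unset Strict Implicit.
Unset Printing Implicit Defensive.

Local Open Scope classical_set_scope.
Local Open Scope ring_scope.

(** * Smooth maps between coordinate spaces *)

(** Charts are total functions with arbitrary values outside their domains, and sections of the
    quotient maps are chosen pointwise, so most equalities between maps hold only near a point.
    Continuity, differentials and smoothness are therefore first shown to be local. Smoothness on a
    quotient is then tested on local lifts: quotient charts are charts upstairs read through the
    quotient map, so that a map and its lift have the same coordinate expression. This keeps the
    calculus small: every expression that occurs is a sum, a pair, or a given smooth map composed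
    with linear maps. The cosines and sines of the torus coordinates serve twice. They separate the
    points of the torus, which makes it Hausdorff, and they reduce the lifting of homotopies to
    explicit arctangents. The isomorphism of fundamental groups is built from pairs to loops,
    because a pair has an explicit loop, whereas the lift of a loop is only known to exist. *)

Lemma near_eq_for_continuous (X Y : topologicalType) (f g : X -> Y) x :
  (\near x, g x = f x) -> {for x, continuous g} -> {for x, continuous f}.
Proof.
move=> gf cg; rewrite /prop_for /continuous_at -(nbhs_singleton gf).
exact: cvg_trans (near_eq_cvg gf) cg.
Qed.

(** ['d] is a chosen linear map, so equality of differentials goes through the uniqueness of the
    little-o expansion, which depends only on values near [x]. *)
Lemma near_eq_differentiable (R : numFieldType) (V W : normedModType R)
    (f g : V -> W) x :
  (\near x, g x = f x) -> differentiable g x ->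
  differentiable f x /\ 'd f x = 'd g x :> (V -> W).
Proof.
move=> gf dg.
have fE : f \o shift x = cst (f x) + 'd g x +o_ 0 id.
  have := diff_locally dg; rewrite -(nbhs_singleton gf) => gE.
  apply/eqaddoP => e e0.
  move: gE => /eqaddoP gE; have {gE} := gE e e0.
  have gf0 : \forall y \near 0, g (y + x) = f (y + x).
    by move: gf; rewrite (near_shift 0 x) subr0.
  by apply: filterS2 gf0 => y /= gfy; rewrite !fctE /= gfy.
have dfE := diff_unique (diff_continuous dg) fE.
by split => //; apply/diff_locallyP; rewrite dfE; split=> //; exact: diff_continuous.
Qed.

Section Matrices.
Variable R : realType.

Lemma rV_for_continuous (X : topologicalType) n (f : X -> 'rV[R]_n) x :
  (forall i, {for x, continuous (fun y => f y ord0 i)}) ->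
  {for x, continuous f}.
Proof.
move=> cf A [P Pf PA].
have {}cf i : \near x, P ord0 i (f x ord0 i) by exact: cf (Pf ord0 i).
have : \near x, forall i, P ord0 i (f x ord0 i) by exact: filter_forall.
by apply: filterS => y Py; apply: PA => i j; rewrite ord1.
Qed.

Lemma row_mx_continuous n m (X : topologicalType) (f : X -> 'rV[R]_n)
    (g : X -> 'rV[R]_m) x : {for x, continuous f} -> {for x, continuous g} ->
  {for x, continuous (fun y => row_mx (f y) (g y))}.
Proof.
move=> cf cg; apply: rV_for_continuous => i.
case: (splitP i) => j ij.
- have -> : i = lshift m j by exact: val_inj.
  apply: (@near_eq_for_continuous _ _ _ (fun y => f y ord0 j)).
    by apply: nearW => y; rewrite row_mxEl.
  apply: (@continuous_comp _ _ _ f (fun u : 'rV[R]_n => u ord0 j)) => //.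
  exact: coord_continuous.
- have -> : i = rshift n j by exact: val_inj.
  apply: (@near_eq_for_continuous _ _ _ (fun y => g y ord0 j)).
    by apply: nearW => y; rewrite row_mxEr.
  apply: (@continuous_comp _ _ _ g (fun u : 'rV[R]_m => u ord0 j)) => //.
  exact: coord_continuous.
Qed.

Definition inlmx n m (u : 'rV[R]_n) : 'rV[R]_(n + m) := row_mx u 0.
Definition inrmx n m (u : 'rV[R]_m) : 'rV[R]_(n + m) := row_mx 0 u.

Fact inlmx_linear n m : linear (@inlmx n m).
Proof. by move=> a u v; rewrite /inlmx scale_row_mx add_row_mx scaler0 addr0. Qed.
Fact inrmx_linear n m : linear (@inrmx n m).
Proof. by move=> a u v; rewrite /inrmx scale_row_mx add_row_mx scaler0 addr0. Qed.
HB.instance Definition _ n m :=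
  GRing.isLinear.Build R _ _ _ (@inlmx n m) (@inlmx_linear n m).
HB.instance Definition _ n m :=
  GRing.isLinear.Build R _ _ _ (@inrmx n m) (@inrmx_linear n m).

Lemma inlmx_continuous n m : continuous (@inlmx n m).
Proof.
move=> u; apply: (@row_mx_continuous _ _ _ id (cst 0)).
  exact: cvg_id.
exact: cst_continuous.
Qed.
Lemma inrmx_continuous n m : continuous (@inrmx n m).
Proof.
move=> u; apply: (@row_mx_continuous _ _ _ (cst 0) id).
  exact: cst_continuous.
exact: cvg_id.
Qed.

End Matrices.

Section Calculus.
Variable R : realType.
Implicit Types n m p : nat.

(** Induction on the order: on the open set [V] the differentials of [f] and [g] agree too, so the
    hypothesis passes to directional derivatives. Openness is asked of [V] and not of [U], so
    coordinate domains can be treated without proving them open. *)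
Lemma Ck_local n m k (U : set 'rV[R]_n) (f : 'rV[R]_n -> 'rV[R]_m) :
  (forall x, U x -> exists (V : set 'rV[R]_n) g, [/\ open V, V x, Ck k V g &
     forall y, V y -> g y = f y]) -> Ck k U f.
Proof.
elim: k f => [|k IH] f H /=.
  move=> x /H[V [g [oV Vx gC gf]]].
  apply: near_eq_for_continuous (gC _ Vx).
  by apply: filterS gf _; exact: open_nbhs_nbhs.
have H1 x : U x -> exists V g, [/\ open V, V x, Ck k.+1 V g &
    forall y, V y -> differentiable f y /\ 'd f y = 'd g y :> (_ -> _)].
  move=> /H[V [g [oV Vx gC gf]]]; exists V, g.
  split; [exact: oV|exact: Vx|exact: gC|move=> y Vy].
  have gfy : \forall z \near y, g z = f z.
    have := open_nbhs_nbhs (conj oV Vy).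
    by apply: filterS.
  case: gC => dg _.
  have dgy := dg y Vy.
  exact: near_eq_differentiable gfy dgy.
split; first by move=> x /H1[V [g [_ Vx _ /(_ _ Vx)[]]]].
move=> v; apply: IH => x /H1[V [g [oV Vx [_ gC] gf]]].
exists V, (fun y => 'd g y v).
split; [exact: oV|exact: Vx|exact: gC v|].
move=> y Vy.
have [_ e] := gf y Vy.
exact: (esym (congr1 (@^~ v) e)).
Qed.

Lemma Ck_eq n m k (U : set 'rV[R]_n) (f g : 'rV[R]_n -> 'rV[R]_m) :
  open U -> (forall x, U x -> g x = f x) -> Ck k U g -> Ck k U f.
Proof. by move=> oU gf gC; apply: Ck_local => x Ux; exists U, g. Qed.

Lemma Ck_subset n m k (U V : set 'rV[R]_n) (f : 'rV[R]_n -> 'rV[R]_m) :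
  V `<=` U -> Ck k U f -> Ck k V f.
Proof.
move=> VU; elim: k f => [|k IH] f /=; first by move=> cf x /VU; exact: cf.
by move=> [df fC]; split => [x /VU|v]; [exact: df|exact/IH/fC].
Qed.

Lemma Cinfty_local n m (U : set 'rV[R]_n) (f : 'rV[R]_n -> 'rV[R]_m) :
  (forall x, U x -> exists (V : set 'rV[R]_n) g, [/\ open V, V x, Cinfty V g &
     forall y, V y -> g y = f y]) -> Cinfty U f.
Proof.
by move=> H k; apply: Ck_local => x /H[V [g [oV Vx gC gf]]]; exists V, g; split.
Qed.

Lemma Cinfty_cst n m (U : set 'rV[R]_n) (a : 'rV[R]_m) :
  Cinfty U (cst a).
Proof.
move=> k; elim: k a => [|k IH] a /=; first by move=> x _; exact: cst_continuous.
split => [x _|v]; first exact: differentiable_cst.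
by under eq_fun do rewrite diff_cst; exact: IH.
Qed.

Lemma Cinfty_linear n m (U : set 'rV[R]_n) (L : {linear 'rV[R]_n -> 'rV[R]_m}) :
  continuous L -> Cinfty U L.
Proof.
move=> cL [|k] /=; first by move=> x _; exact: cL.
split => [x _|v]; first exact: linear_differentiable.
by under eq_fun do rewrite diff_lin//; exact: Cinfty_cst.
Qed.

Lemma Cinfty_add n m (U : set 'rV[R]_n) (f g : 'rV[R]_n -> 'rV[R]_m) :
  open U -> Cinfty U f -> Cinfty U g -> Cinfty U (fun x => f x + g x).
Proof.
move=> oU fC gC k; move: (fC k) (gC k) => {fC gC}.
elim: k f g => [|k IH] f g /=.
  by move=> cf cg x Ux; apply: continuousD; [exact: cf|exact: cg].
move=> [df fC] [dg gC]; split => [x Ux|v].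
  by apply: (@differentiableD _ _ _ f g); [exact: df|exact: dg].
apply: (Ck_eq oU _ (IH _ _ (fC v) (gC v))) => x Ux.
have e := diffD (df x Ux) (dg x Ux).
exact: (esym (congr1 (@^~ v) e)).
Qed.

Lemma Cinfty_comp_linearl n m p (U : set 'rV[R]_n) (f : 'rV[R]_n -> 'rV[R]_m)
    (L : {linear 'rV[R]_m -> 'rV[R]_p}) :
  open U -> continuous L -> Cinfty U f -> Cinfty U (fun x => L (f x)).
Proof.
move=> oU cL fC k; move: (fC k) => {fC}.
elim: k f => [|k IH] f /=.
  by move=> cf x Ux; apply: continuous_comp; [exact: cf|exact: cL].
move=> [df fC]; split => [x Ux|v].
  by apply: (@differentiable_comp _ _ _ _ f L); [exact: df|exact: linear_differentiable].
apply: (Ck_eq oU _ (IH _ (fC v))) => x Ux.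
have e := diff_comp (df x Ux) (linear_differentiable (f x) cL).
by rewrite [RHS](congr1 (@^~ v) e) /= [RHS](congr1 (@^~ _) (diff_lin (f x) cL)).
Qed.

Lemma Cinfty_comp_linearr n m p (U : set 'rV[R]_m) (f : 'rV[R]_m -> 'rV[R]_p)
    (L : {linear 'rV[R]_n -> 'rV[R]_m}) :
  open U -> continuous L -> Cinfty U f -> Cinfty (L @^-1` U) (fun x => f (L x)).
Proof.
move=> oU cL fC k; move: (fC k) => {fC}.
have oLU : open (L @^-1` U) by apply: open_comp => // x _; exact: cL.
elim: k f => [|k IH] f /=.
  by move=> cf x Ux; apply: continuous_comp; [exact: cL|exact: cf].
move=> [df fC]; split => [x Ux|v].
  by apply: (@differentiable_comp _ _ _ _ L f); [exact: linear_differentiable|exact: df].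
apply: (Ck_eq oLU _ (IH _ (fC (L v)))) => x Ux.
have e := diff_comp (linear_differentiable x cL) (df _ Ux).
by rewrite [RHS](congr1 (@^~ v) e) /= (congr1 (@^~ v) (diff_lin x cL)).
Qed.

Lemma Cinfty_row_mx n m p (U : set 'rV[R]_n) (f : 'rV[R]_n -> 'rV[R]_m)
    (g : 'rV[R]_n -> 'rV[R]_p) :
  open U -> Cinfty U f -> Cinfty U g -> Cinfty U (fun x => row_mx (f x) (g x)).
Proof.
move=> oU fC gC.
(* Pairing becomes a sum of two compositions with linear inclusions. *)
have -> : (fun x => row_mx (f x) (g x)) =
    (fun x => inlmx p (f x) + inrmx m (g x)).
  by apply/funext => x; rewrite add_row_mx addr0 add0r.
apply: Cinfty_add => //; apply: Cinfty_comp_linearl => //.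
  exact: inlmx_continuous.
exact: inrmx_continuous.
Qed.

Lemma Cinfty_subset n m (U V : set 'rV[R]_n) (f : 'rV[R]_n -> 'rV[R]_m) :
  V `<=` U -> Cinfty U f -> Cinfty V f.
Proof. by move=> VU fC k; apply: Ck_subset (fC k). Qed.

End Calculus.

(** * Smooth structures on quotients and products *)

Lemma open_map_nbhs (X Y : topologicalType) (q : X -> Y) x (A : set X) :
  (forall U, open U -> open (q @` U)) -> nbhs x A -> nbhs (q x) (q @` A).
Proof.
move=> oq; rewrite (nbhsE x) (nbhsE (q x)) => -[B [oB Bx] BA]; exists (q @` B).
  by split; [exact: oq|exists x].
exact: image_subset.
Qed.

(** An open map sends neighborhoods of [x] to neighborhoods of [q x], so continuity of [f \o q] at a
    single preimage is enough. *)
Lemma open_map_for_continuous (X Y Z : topologicalType) (q : X -> Y)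
    (f : Y -> Z) x :
  (forall U, open U -> open (q @` U)) ->
  {for x, continuous (f \o q)} -> {for (q x), continuous f}.
Proof.
move=> oq cfq A Afqx; have /(open_map_nbhs oq) : nbhs x ((f \o q) @^-1` A).
  exact: cfq.
by apply: filterS => _ [z fqz <-].
Qed.

Lemma open_map_open (X Y : topologicalType) (q : X -> Y) :
  (forall x A, nbhs x A -> nbhs (q x) (q @` A)) ->
  forall U, open U -> open (q @` U).
Proof.
move=> qN U oU; rewrite openE => _ [x Ux <-]; apply: qN.
exact: open_nbhs_nbhs.
Qed.

Lemma pair_for_continuous (X Y Z : topologicalType) (f : X -> Y) (g : X -> Z) x :
  {for x, continuous f} -> {for x, continuous g} ->
  {for x, continuous (fun y => (f y, g y))}.
Proof. by move=> cf cg; apply: cvg_pair; [exact: cf|exact: cg]. Qed.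

Lemma open_setX (X Y : topologicalType) (A : set X) (B : set Y) :
  open A -> open B -> open (A `*` B).
Proof.
move=> oA oB; rewrite openE => -[x y] [/= Ax By].
by exists (A, B) => //; split => /=; exact: open_nbhs_nbhs.
Qed.

Section Charts.
Variable R : realType.

Lemma chart_open n (X : topologicalType) (c : chart R n X) (W : set X) :
  open W -> W `<=` cdom c -> open (c @` W).
Proof.
move=> oW Wc.
have -> : c @` W = (c @` cdom c) `&` cinv c @^-1` W.
  apply/seteqP; split.
    by move=> _ [x Wx <-]; split; [exists x => //; exact: Wc|rewrite /= cmapK//; exact: Wc].
  by move=> _ [[x cx <-]]; rewrite /= cmapK// => Wx; exists x.
rewrite openE => u [cu Wu]; apply: filterI.
  by apply: open_nbhs_nbhs; split => //; exact: crange_open.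
by apply: (cinv_cts cu); exact: open_nbhs_nbhs.
Qed.

(** Compatibility of charts is smoothness of the identity in coordinates, so the criterion for
    smooth maps below also produces atlases. *)
Lemma compatible_of_smooth_id n (X : topologicalType) (A B : set (chart R n X)) :
  smooth A B id -> smooth B A id ->
  forall c d, A c -> B d -> chart_compatible c d.
Proof.
move=> [_ sAB] [_ sBA] c d Ac Bd; split.
  by have := sAB c d Ac Bd; rewrite setTI.
by have := sBA d c Bd Ac; rewrite setTI setIC.
Qed.

Section Model.
Variables (n : nat) (X Y : topologicalType).

(* Around each point, every chart in B is a chart in A read through q: this
   covers both quotient atlases and, with q the identity, plain atlases. *)
Definition modelled (B : set (chart R n Y)) (A : set (chart R n X)) (q : X -> Y) :=
  forall e y, B e -> cdom e y -> exists x c W, [/\ q x = y, A c,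
    open W /\ W x, W `<=` cdom c & forall z, W z -> cdom e (q z) /\ e (q z) = c z].

Lemma modelled_quotient (A : set (chart R n X)) (q : X -> Y) :
  modelled (quotient_atlas A q) A q.
Proof.
move=> e y [c [W [[Ac oW] Wc Wq ed eq]]]; rewrite ed => -[x Wx <-].
exists x, c, W; split => // z Wz; split; last exact: eq.
by exists z.
Qed.

Section QuotientChart.
Variables (q : X -> Y) (c : chart R n X) (W : set X).
Hypotheses (cq : continuous q) (oq : forall U, open U -> open (q @` U)).
Hypotheses (oW : open W) (Wc : W `<=` cdom c).
Hypothesis qW : forall x y, W x -> W y -> q x = q y -> x = y.

(** The inverse branch of [q] on [W], followed by [c]; the value is 0 outside the image of [W]. *)
Let f (y : Y) : 'rV[R]_n := xget 0 [set c x | x in W `&` q @^-1` [set y]].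

Let fE x : W x -> f (q x) = c x.
Proof.
move=> Wx; rewrite /f.
have : exists u, [set c z | z in W `&` q @^-1` [set q x]] u by exists (c x), x.
by move=> /(xgetPex 0) [z [Wz /= /(qW Wz Wx) <-] <-].
Qed.

Let fqW : f @` (q @` W) = c @` W.
Proof.
apply/seteqP; split; first by move=> _ [_ [x Wx <-] <-]; rewrite fE//; exists x.
by move=> _ [x Wx <-]; exists (q x); [exists x|rewrite fE].
Qed.

Let f_open : open (f @` (q @` W)).
Proof. by rewrite fqW; exact: chart_open. Qed.

Let fK y : (q @` W) y -> q (cinv c (f y)) = y.
Proof. by move=> [x Wx <-]; rewrite fE// cmapK//; exact: Wc. Qed.

Let f_cts y : (q @` W) y -> {for y, continuous f}.
Proof.
move=> [x Wx <-]; apply: (open_map_for_continuous oq).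
apply: (@near_eq_for_continuous _ _ _ c); last exact/cmap_cts/Wc.
have : nbhs x W by exact: open_nbhs_nbhs.
by apply: filterS => z Wz; rewrite /= fE.
Qed.

Let finv_cts u : (f @` (q @` W)) u -> {for u, continuous (q \o cinv c)}.
Proof.
rewrite fqW => -[x Wx <-]; apply: continuous_comp; last exact: cq.
by apply: cinv_cts; exists x => //; exact: Wc.
Qed.

Lemma quotient_chart : exists e : chart R n Y, cdom e = q @` W /\
  forall x, W x -> e (q x) = c x.
Proof.
by exists (Chart (oq oW) f_open fK f_cts finv_cts); split => // x /fE.
Qed.

End QuotientChart.
End Model.

Lemma modelled_id n (X : topologicalType) (A : set (chart R n X)) :
  modelled A A id.
Proof.
move=> e y Ae ey; exists y, e, (cdom e); split => //.
by split => //; exact: cdom_open.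
Qed.

Section SmoothModelled.
Variables (n m : nat) (X Y X' Y' : topologicalType).
Variables (A : set (chart R n X)) (B : set (chart R n Y)) (q : X -> Y).
Variables (A' : set (chart R m X')) (B' : set (chart R m Y')) (q' : X' -> Y').
Hypotheses (mB : modelled B A q) (mB' : modelled B' A' q').
Hypotheses (oq : forall U, open U -> open (q @` U)) (cq' : continuous q').
Hypotheses (sq : forall y, exists x, q x = y) (sq' : forall y, exists x, q' x = y).

(** The single criterion behind the quotient atlases, the projection and the trivialization. A local
    lift [g] may be chosen for each pair of lifts [x], [x'] of a point and its value; near that
    point the expression of [f] in charts is that of [g]. *)
Lemma smooth_modelled (U : set Y) (f : Y -> Y') :
  (forall x x', U (q x) -> f (q x) = q' x' -> exists V g,
    [/\ open V, V x, smooth A A' g, g x = x' &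
        forall z, V z -> f (q z) = q' (g z)]) ->
  smooth_on B B' U f.
Proof.
move=> H; split.
  move=> y; have [x <-] := sq y => Ux; have [x' fx] := sq' (f (q x)).
  have [V [g [oV Vx [cg _] gx fg]]] := H x x' Ux (esym fx).
  apply: open_map_for_continuous => //.
  apply: (@near_eq_for_continuous _ _ _ (q' \o g)).
    have : nbhs x V by exact: open_nbhs_nbhs.
    by apply: filterS => z Vz; rewrite /= fg.
  by apply: continuous_comp; [exact: cg|exact: cq'].
move=> e e' Be Be'; apply: Cinfty_local => _ [y [[Uy ey] e'fy] <-].
have [x [c [W [qx Ac [oW Wx] Wc We]]]] := mB Be ey.
have [x' [c' [W' [qx' Ac' [oW' Wx'] Wc' We']]]] := mB' Be' e'fy.
move: Uy; rewrite -qx => Uy.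
have fx' : f (q x) = q' x' by rewrite qx qx'.
have [V [g [oV Vx [cg sg] gx fg]]] := H x x' Uy fx'.
(* Here [g] lifts [f], and the charts at the source and at the target both agree with charts
   upstairs. *)
pose N := W `&` V `&` g @^-1` W'.
exists (c @` N), (c' \o g \o cinv c); split.
- apply: chart_open; last by move=> z [[/Wc]].
  apply: openI; first exact: openI.
  by apply: open_comp => // z _; exact: cg.
- by exists x; [split => //=; rewrite gx|rewrite (We x Wx).2].
- apply: Cinfty_subset (sg c c' Ac Ac') => _ [z [[Wz Vz] Wz'] <-].
  by exists z => //; split; [split => //; exact: Wc|exact: Wc'].
- move=> _ [z [[Wz Vz] Wz'] <-] /=.
  rewrite cmapK; last exact: Wc.
  by have [eqz <-] := We z Wz; rewrite cmapK// fg// (We' _ Wz').2.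
Qed.

End SmoothModelled.

Section Products.
Variables (n m : nat) (X Y : topologicalType).

Section ProdChart.
Variables (c : chart R n X) (d : chart R m Y).

Let D := cdom c `*` cdom d.
Let f (p : X * Y) := row_mx (c p.1) (d p.2).
Let g (u : 'rV[R]_(n + m)) := (cinv c (lsubmx u), cinv d (rsubmx u)).

Let fDE : f @` D = lsubmx @^-1` (c @` cdom c) `&` rsubmx @^-1` (d @` cdom d).
Proof.
apply/seteqP; split.
  move=> _ [[x y] [/= cx dy] <-]; rewrite /f/=.
  by split; rewrite /= ?row_mxKl ?row_mxKr; [exists x|exists y].
move=> u [[x cx xE] [y dy yE]]; exists (x, y) => //.
by rewrite /f /= xE yE hsubmxK.
Qed.

Let D_open : open D.
Proof. by apply: open_setX; exact: cdom_open. Qed.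

Let fD_open : open (f @` D).
Proof.
rewrite fDE; apply: openI; apply: open_comp; try exact: crange_open.
  by move=> u _; exact: continuous_lsubmx.
by move=> u _; exact: continuous_rsubmx.
Qed.

Let fK p : D p -> g (f p) = p.
Proof. by case: p => x y [/= cx dy]; rewrite /g /f/= row_mxKl row_mxKr !cmapK. Qed.

Let f_cts p : D p -> {for p, continuous f}.
Proof.
move=> [cx dy]; apply: row_mx_continuous.
  by apply: (@continuous_comp _ _ _ fst c); [exact: cvg_fst|exact: cmap_cts].
by apply: (@continuous_comp _ _ _ snd d); [exact: cvg_snd|exact: cmap_cts].
Qed.

Let g_cts u : (f @` D) u -> {for u, continuous g}.
Proof.
rewrite fDE => -[cu du]; apply: pair_for_continuous.
  apply: (@continuous_comp _ _ _ lsubmx (cinv c)); last exact: cinv_cts.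
  exact: continuous_lsubmx.
apply: (@continuous_comp _ _ _ rsubmx (cinv d)); last exact: cinv_cts.
exact: continuous_rsubmx.
Qed.

Lemma prod_chart : exists e : chart R (n + m) (X * Y)%type,
  cdom e = cdom c `*` cdom d /\ forall p, e p = row_mx (c p.1) (d p.2).
Proof. by exists (Chart D_open fD_open fK f_cts g_cts). Qed.

End ProdChart.

Variables (A : set (chart R n X)) (B : set (chart R m Y)).

Lemma prod_atlas_cover : (forall x, exists2 c, A c & cdom c x) ->
  (forall y, exists2 d, B d & cdom d y) ->
  forall p, exists2 e, prod_atlas A B e & cdom e p.
Proof.
move=> cA cB [x y]; have [c Ac cx] := cA x; have [d Bd dy] := cB y.
have [e [ed eE]] := prod_chart c d; exists e; last by rewrite ed.
by exists c, d; split.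
Qed.

(** In product charts this is the expression of [f] precomposed with the linear map [lsubmx]. *)
Lemma smooth_comp_fst p (Z : topologicalType) (C : set (chart R p Z)) (f : X -> Z) :
  smooth A C f -> smooth (prod_atlas A B) C (f \o fst).
Proof.
move=> [cf sf]; split.
  by move=> x _; apply: continuous_comp; [exact: cvg_fst|exact: cf].
move=> e c' [c [d [Ac Bd ed eE]]] Cc'.
apply: Cinfty_local => _ [[x y] [[_ edx] c'fx] <-].
have oS : open (c @` (setT `&` cdom c `&` f @^-1` cdom c')).
  apply: chart_open; last by move=> z [[]].
  rewrite setTI; apply: openI; first exact: cdom_open.
  by apply: open_comp; [move=> z _; exact: cf|exact: cdom_open].
pose T := @lsubmx R 1 n m @^-1` (c @` (setT `&` cdom c `&` f @^-1` cdom c')) `&`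
  e @` cdom e.
exists T, (fun u => (c' \o f \o cinv c) (lsubmx u)); split.
- apply: openI; last exact: crange_open.
  by apply: open_comp => // u _; exact: continuous_lsubmx.
- split; last by exists (x, y).
  rewrite /= eE// row_mxKl; exists x => //; split => //; split => //.
  by move: edx; rewrite ed => -[].
- apply: (Cinfty_subset _ (Cinfty_comp_linearr oS _ (sf c c' Ac Cc'))).
    by move=> u [].
  exact: continuous_lsubmx.
- move=> _ [_ [[x' y'] ex' <-]] /=; rewrite cmapK// eE// row_mxKl/= cmapK//.
  by move: ex'; rewrite ed => -[].
Qed.

Lemma smooth_comp_snd p (Z : topologicalType) (C : set (chart R p Z)) (f : Y -> Z) :
  smooth B C f -> smooth (prod_atlas A B) C (f \o snd).
Proof.
move=> [cf sf]; split.
  by move=> x _; apply: continuous_comp; [exact: cvg_snd|exact: cf].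
move=> e c' [c [d [Ac Bd ed eE]]] Cc'.
apply: Cinfty_local => _ [[x y] [[_ edx] c'fx] <-].
have oS : open (d @` (setT `&` cdom d `&` f @^-1` cdom c')).
  apply: chart_open; last by move=> z [[]].
  rewrite setTI; apply: openI; first exact: cdom_open.
  by apply: open_comp; [move=> z _; exact: cf|exact: cdom_open].
pose T := @rsubmx R 1 n m @^-1` (d @` (setT `&` cdom d `&` f @^-1` cdom c')) `&`
  e @` cdom e.
exists T, (fun u => (c' \o f \o cinv d) (rsubmx u)); split.
- apply: openI; last exact: crange_open.
  by apply: open_comp => // u _; exact: continuous_rsubmx.
- split; last by exists (x, y).
  rewrite /= eE// row_mxKr; exists y => //; split => //; split => //.
  by move: edx; rewrite ed => -[].
- apply: (Cinfty_subset _ (Cinfty_comp_linearr oS _ (sf d c' Bd Cc'))).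
    by move=> u [].
  exact: continuous_rsubmx.
- move=> _ [_ [[x' y'] ex' <-]] /=; rewrite cmapK// eE// row_mxKr/= cmapK//.
  by move: ex'; rewrite ed => -[].
Qed.

Lemma smooth_pair p r (Z W : topologicalType) (C : set (chart R p Z))
    (D : set (chart R r W)) (f : X -> Z) (g : X -> W) :
  smooth A C f -> smooth A D g ->
  smooth A (prod_atlas C D) (fun x => (f x, g x)).
Proof.
move=> [cf sf] [cg sg]; split.
  by move=> x _; apply: pair_for_continuous; [exact: cf|exact: cg].
move=> c e Ac [c' [d' [Cc' Dd' ed eE]]].
have oS : open (c @` (setT `&` cdom c `&` (fun x => (f x, g x)) @^-1` cdom e)).
  apply: chart_open; last by move=> z [[]].
  rewrite setTI; apply: openI; first exact: cdom_open.
  apply: open_comp; last exact: cdom_open.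
  by move=> z _; apply: pair_for_continuous; [exact: cf|exact: cg].
apply: Cinfty_local => u cu.
exists (c @` (setT `&` cdom c `&` (fun x => (f x, g x)) @^-1` cdom e)).
exists (fun u => row_mx ((c' \o f \o cinv c) u) ((d' \o g \o cinv c) u)).
split => //.
  apply: Cinfty_row_mx => //.
    apply: Cinfty_subset (sf c c' Ac Cc') => _ [x [cx ex] <-].
    by exists x => //; split => //; move: ex; rewrite /= ed => -[].
  apply: Cinfty_subset (sg c d' Ac Dd') => _ [x [cx ex] <-].
  by exists x => //; split => //; move: ex; rewrite /= ed => -[].
by move=> _ [x [[_ cx] ex] <-] /=; rewrite cmapK// eE.
Qed.

End Products.

Lemma smooth_prod_map n m p r (X Y Z W : topologicalType) (A : set (chart R n X))
    (B : set (chart R m Y)) (C : set (chart R p Z)) (D : set (chart R r W))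
    (f : X -> Z) (g : Y -> W) : smooth A C f -> smooth B D g ->
  smooth (prod_atlas A B) (prod_atlas C D) (fun p => (f p.1, g p.2)).
Proof.
move=> sf sg; apply: (@smooth_pair _ _ _ _ _ _ _ _ _ (f \o fst) (g \o snd)).
  exact: smooth_comp_fst.
exact: smooth_comp_snd.
Qed.

End Charts.

(** * Orbit spaces of actions of Z^2 *)

Section Orbits.
Variables (X : topologicalType) (a : Z2action X).

Lemma orbit_piP x y : orbit_pi a x = orbit_pi a y <-> exists v, a v x = y.
Proof. by split => [/eqmodP/asboolP|?]; [|apply/eqmodP/asboolP]. Qed.

Lemma orbit_piK y : orbit_pi a (orbit_repr y) = y.
Proof. exact: reprK. Qed.

Lemma orbit_pi_act v x : orbit_pi a (a v x) = orbit_pi a x.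
Proof. by apply/esym/orbit_piP; exists v. Qed.

Lemma orbit_pi_continuous : continuous (orbit_pi a).
Proof. exact: pi_continuous. Qed.

Lemma orbit_pi_open : (forall v, continuous (a v)) ->
  forall U, open U -> open (orbit_pi a @` U).
Proof.
move=> ca U oU.
have -> : open (orbit_pi a @` U) = open (orbit_pi a @^-1` (orbit_pi a @` U)).
  by [].
(* The saturation of [U] is a union of preimages of [U] under the homeomorphisms of the action. *)
have -> : orbit_pi a @^-1` (orbit_pi a @` U) = \bigcup_v (a v @^-1` U).
  apply/seteqP; split => [x [y Uy /esym/orbit_piP[v vxy]]|x [v _ /= Uvx]].
    by exists v => //=; rewrite vxy.
  by exists (a v x) => //; rewrite orbit_pi_act.
apply: bigcup_open => v _; apply: open_comp => // x _; exact: ca.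
Qed.

End Orbits.

Section SmoothOrbits.
Variables (R : realType) (n : nat) (X : topologicalType).
Variables (A : set (chart R n X)) (a : Z2action X).
Hypotheses (sa : forall v, smooth A A (a v)).
Hypotheses (dA : forall x, exists2 c, A c & cdom c x).
Hypothesis a_disc : forall x, exists2 W : set X, open W /\ W x &
  forall y z, W y -> W z -> orbit_pi a y = orbit_pi a z -> y = z.

Let ca v : continuous (a v).
Proof. by move=> x; have [ca _] := sa v; exact: ca. Qed.

Lemma orbit_atlas : smooth_atlas (quotient_atlas A (orbit_pi a)).
Proof.
split.
  move=> y; have <- := orbit_piK y; move: (orbit_repr y) => x.
  have [c Ac cx] := dA x; have [W [oW Wx] Wi] := a_disc x.
  have oWc : open (W `&` cdom c) by apply: openI => //; exact: cdom_open.
  have sWc : W `&` cdom c `<=` cdom c by move=> z [].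
  have iWc z t : (W `&` cdom c) z -> (W `&` cdom c) t ->
      orbit_pi a z = orbit_pi a t -> z = t by move=> [Wz _] [Wt _]; exact: Wi.
  have [e [ed ec]] := quotient_chart (@orbit_pi_continuous _ a)
    (orbit_pi_open ca) oWc sWc iWc.
  exists e; last by rewrite ed; exists x.
  by exists c, (W `&` cdom c); split.
have sid : smooth (quotient_atlas A (orbit_pi a))
    (quotient_atlas A (orbit_pi a)) id.
  apply: (@smooth_modelled R n n _ _ _ _ A _ (orbit_pi a) A _ (orbit_pi a)).
  - exact: modelled_quotient.
  - exact: modelled_quotient.
  - exact: orbit_pi_open.
  - exact: orbit_pi_continuous.
  - by move=> y; exists (orbit_repr y); exact: orbit_piK.
  - by move=> y; exists (orbit_repr y); exact: orbit_piK.
  (* Two lifts of one point differ by some [a v], which is then a lift of the identity. *)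
  - move=> x x' _ /orbit_piP[v vx]; exists setT, (a v); split => //.
      exact: openT.
    by move=> z _; rewrite orbit_pi_act.
exact: compatible_of_smooth_id.
Qed.

End SmoothOrbits.

(** * The torus and the flat total space as quotients *)

Lemma translate_continuous (R : realType) v : continuous (@translate R v).
Proof.
move=> u; rewrite /translate.
by apply: (@continuousD _ _ _ id (cst _)); [exact: cvg_id|exact: cst_continuous].
Qed.

Section SpaceAtlas.
Variable R : realType.

Lemma space_cinv n (c : chart R n 'rV[R]_n) u : space_atlas R n c -> cinv c u = u.
Proof. by move=> [cT cE]; rewrite -{1}(cE u) cmapK// cT. Qed.

Lemma smooth_translate v : smooth (space_atlas R 2) (space_atlas R 2) (translate v).
Proof.
split; first by move=> u _; exact: translate_continuous.
move=> c d Ac Ad.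
have -> : d \o translate v \o cinv c = fun u => id u + cst (Z2_to_R2 R v) u.
  by apply/funext => u /=; rewrite space_cinv// Ad.2.
apply: (@Cinfty_subset _ _ _ setT) => //; apply: Cinfty_add.
- exact: openT.
- by apply: (@Cinfty_linear _ _ _ _ idfun) => u; exact: cvg_id.
- exact: Cinfty_cst.
Qed.

Fact idmx_range_open n : open ((@id 'rV[R]_n) @` setT).
Proof. by rewrite image_id; exact: openT. Qed.

Lemma space_atlas_cover n (u : 'rV[R]_n) : exists2 c, space_atlas R n c & cdom c u.
Proof.
exists (@Chart R n 'rV[R]_n setT id id openT (@idmx_range_open n)
  (fun _ _ => erefl) (fun u _ => @cvg_id _ (nbhs u))
  (fun u _ => @cvg_id _ (nbhs u))) => //.
Qed.

End SpaceAtlas.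

Section Lattice.
Variable R : realType.

Lemma coord_le_norm n (u : 'rV[R]_n) i : `|u ord0 i| <= `|u|.
Proof.
rewrite -[leRHS]/(mx_norm u) mx_normrE.
exact: (le_bigmax _ (fun ij : 'I_1 * 'I_n => `|u ij.1 ij.2|) (ord0, i)).
Qed.

Lemma Z2_to_R2_small v : `|Z2_to_R2 R v| < 1 -> v = 0.
Proof.
move=> v1; apply/rowP => i; rewrite mxE; apply/eqP.
have : `|Z2_to_R2 R v ord0 i| < 1.
  exact: le_lt_trans (coord_le_norm _ _) v1.
by rewrite mxE -intr_norm ltrz1 -abszE ltz_nat ltnS leqn0 absz_eq0.
Qed.

End Lattice.

Lemma open_map_prod (X Y Z W : topologicalType) (q : X -> Y) (r : Z -> W) :
  (forall U, open U -> open (q @` U)) -> (forall U, open U -> open (r @` U)) ->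
  forall U, open U -> open ((fun p => (q p.1, r p.2)) @` U).
Proof.
move=> oq or_; apply: open_map_open => -[x z] A [[B C] [/= Bx Cz] BCA].
exists (q @` B, r @` C); first by split => /=; exact: open_map_nbhs.
by move=> [_ _] [/= [b Bb <-] [c Cc <-]]; exists (b, c) => //; exact: BCA.
Qed.

(** Makes ['rV[R]_2 * F] a model for the product of the torus with [F], the source of the
    trivialization. *)
Lemma modelled_prod (R : realType) n m (X Y X' Y' : topologicalType)
    (A : set (chart R n X)) (B : set (chart R n Y)) (q : X -> Y)
    (A' : set (chart R m X')) (B' : set (chart R m Y')) (q' : X' -> Y') :
  modelled B A q -> modelled B' A' q' ->
  modelled (prod_atlas B B') (prod_atlas A A') (fun p => (q p.1, q' p.2)).
Proof.
move=> mB mB' e [y y'] [b [b' [Bb Bb' ed eE]]].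
rewrite ed => -[/= yb yb'].
have [x [c [W [qx Ac [oW Wx] Wc bc]]]] := mB b y Bb yb.
have [x' [c' [W' [qx' Ac' [oW' Wx'] Wc' bc']]]] := mB' b' y' Bb' yb'.
have [d [dd dE]] := prod_chart c c'.
exists (x, x'), d, (W `*` W'); split.
- by rewrite /= qx qx'.
- by exists c, c'; split.
- by split => //; exact: open_setX.
- by rewrite dd => -[z z'] [/= Wz Wz']; split; [exact: Wc|exact: Wc'].
- move=> [z z'] [/= Wz Wz']; have [bz bzE] := bc z Wz; have [bz' bzE'] := bc' z' Wz'.
  by split => //; rewrite eE ?ed//= dE /= bzE bzE'.
Qed.

Section SmallVectors.
Variable R : realType.
Implicit Types u w : 'rV[R]_2.

Lemma rV_norm_lt n (u : 'rV[R]_n) e : 0 < e -> (forall i, `|u ord0 i| < e) -> `|u| < e.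
Proof.
move=> e0 ue; rewrite -[ltLHS]/(mx_norm u) mx_normrE.
apply/bigmax_ltP; split => // -[i j] _ /=; rewrite (ord1 i); exact: ue.
Qed.

Definition small_cube : set 'rV[R]_2 := [set u | `|u| < 2^-1].

(** Two points within 1/2 of a common center differ by less than 1 in sup-norm, and 0 is the only
    lattice vector that short. *)
Lemma translate_near v u w c : `|u - c| < 2^-1 -> `|w - c| < 2^-1 ->
  translate v u = w -> v = 0.
Proof.
move=> uc wc vuw; apply: (@Z2_to_R2_small R).
have -> : Z2_to_R2 R v = (w - c) - (u - c).
  by rewrite opprB addrA subrK -vuw /translate addrAC subrr add0r.
by rewrite (le_lt_trans (ler_normB _ _))// [ltRHS]splitr div1r ltrD.
Qed.

Lemma torus_pi_open U : open U -> open (@torus_pi R @` U).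
Proof. by apply: orbit_pi_open => v; exact: translate_continuous. Qed.

Lemma torus_pi_continuous : continuous (@torus_pi R).
Proof. exact: orbit_pi_continuous. Qed.

Lemma torus_pi_near u w c : `|u - c| < 2^-1 -> `|w - c| < 2^-1 ->
  torus_pi u = torus_pi w -> u = w.
Proof.
move=> uc wc /orbit_piP[v vuw].
by have v0 := translate_near uc wc vuw; rewrite -vuw v0 /= translate0.
Qed.

Lemma open_norm_sub n e c : open [set u : 'rV[R]_n | `|u - c| < e].
Proof.
apply: (@open_comp _ _ (fun u : 'rV[R]_n => `|u - c|) [set x | x < e]);
  last exact: open_lt.
move=> u _; apply: (@continuous_comp _ _ _ (fun u : 'rV[R]_n => u - c)
  (fun u : 'rV[R]_n => `|u|)).
  by apply: (@continuousB _ _ _ id (cst c)); [exact: cvg_id|exact: cst_continuous].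
exact: norm_continuous.
Qed.

Lemma nbhs_norm_sub n e (c : 'rV[R]_n) : 0 < e -> nbhs c [set u | `|u - c| < e].
Proof.
move=> e0; apply: open_nbhs_nbhs; split; first exact: open_norm_sub.
by rewrite /= subrr normr0.
Qed.

Lemma torus_disc u : exists2 W, open W /\ W u &
  forall y z, W y -> W z -> torus_pi y = torus_pi z -> y = z.
Proof.
exists [set w | `|w - u| < 2^-1]; last by move=> y z; exact: torus_pi_near.
by split; [exact: open_norm_sub|rewrite /= subrr normr0 invr_gt0 ltr0n].
Qed.

Lemma torus_smooth_atlas : smooth_atlas (torus_atlas R).
Proof.
apply: orbit_atlas; [exact: smooth_translate|exact: space_atlas_cover|].
exact: torus_disc.
Qed.

(* An inverse of torus_pi on the image of the small cube, 0 elsewhere. *)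
Definition torus_lift (b : torus R) : 'rV[R]_2 :=
  xget 0 [set u | small_cube u /\ torus_pi u = b].

Lemma torus_liftK u : small_cube u -> torus_lift (torus_pi u) = u.
Proof.
move=> su; rewrite /torus_lift.
have : exists w, [set w | small_cube w /\ torus_pi w = torus_pi u] w by exists u.
move=> /(xgetPex 0)[sw]; apply: (@torus_pi_near _ _ 0); rewrite subr0//.
Qed.

End SmallVectors.

Section Flat.
Variables (R : realType) (F : topologicalType) (AF : set (chart R 2 F)).
Variables (rho : Z2action F).
Hypothesis srho : forall v, smooth AF AF (rho v).
Hypothesis cAF : smooth_atlas AF.

Local Notation M := (flat_total R rho).
Local Notation pi := (@flat_pi R F rho).
Local Notation proj := (flat_proj R rho).
Local Notation P := (prod_atlas (space_atlas R 2) AF).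

Lemma smooth_diagonal v : smooth P P (diagonal_action R rho v).
Proof.
exact: (@smooth_prod_map _ _ _ _ _ _ _ _ _ _ _ _ _ (translate v) (rho v))
  (smooth_translate R v) (srho v).
Qed.

Lemma flat_pi_open U : open U -> open (pi @` U).
Proof.
apply: orbit_pi_open => v p; have [cd _] := smooth_diagonal v; exact: cd.
Qed.

Lemma flat_pi_continuous : continuous pi.
Proof. exact: orbit_pi_continuous. Qed.

Lemma flat_pi_surj e : exists p, pi p = e.
Proof. by exists (orbit_repr e); exact: orbit_piK. Qed.

Lemma flat_pi_near u w x y c : `|u - c| < 2^-1 -> `|w - c| < 2^-1 ->
  pi (u, x) = pi (w, y) -> u = w /\ x = y.
Proof.
move=> uc wc /orbit_piP[v [vuw vxy]].
by have v0 := translate_near uc wc vuw; rewrite -vuw -vxy v0 /= translate0 act0.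
Qed.

Lemma flat_piP u w x y : pi (u, x) = pi (w, y) <->
  exists v, u + Z2_to_R2 R v = w /\ rho v x = y.
Proof.
split => [/orbit_piP[v [<- <-]]|[v [<- <-]]]; first by exists v.
by apply/orbit_piP; exists v.
Qed.

Lemma flat_disc p : exists2 W, open W /\ W p &
  forall y z, W y -> W z -> pi y = pi z -> y = z.
Proof.
exists ([set w | `|w - p.1| < 2^-1] `*` setT).
  split; first by apply: open_setX; [exact: open_norm_sub|exact: openT].
  by split => //=; rewrite subrr normr0 invr_gt0 ltr0n.
by move=> [u x] [w y] [/= uc _] [/= wc _] /(flat_pi_near uc wc)[-> ->].
Qed.

Lemma flat_smooth_atlas : smooth_atlas (flat_atlas rho AF).
Proof.
apply: orbit_atlas; [exact: smooth_diagonal| |exact: flat_disc].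
by apply: prod_atlas_cover; [exact: space_atlas_cover|case: cAF].
Qed.

Lemma flat_proj_continuous : continuous proj.
Proof.
move=> e; have [p <-] := flat_pi_surj e.
apply: open_map_for_continuous; first exact: flat_pi_open.
have -> : proj \o pi = @torus_pi R \o fst.
  by apply/funext => q; exact: flat_projE.
by apply: continuous_comp; [exact: cvg_fst|exact: torus_pi_continuous].
Qed.

Lemma flat_proj_smooth : smooth (flat_atlas rho AF) (torus_atlas R) proj.
Proof.
apply: (@smooth_modelled R _ _ _ _ _ _ P _ pi (space_atlas R 2) _ (@torus_pi R)).
- exact: modelled_quotient.
- exact: modelled_quotient.
- exact: flat_pi_open.
- exact: torus_pi_continuous.
- exact: flat_pi_surj.
- by move=> y; exists (orbit_repr y); exact: orbit_piK.
- move=> p u _; rewrite flat_projE => /orbit_piP[v vpu].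
  exists setT, (translate v \o fst).
  split; [exact: openT|by []| |exact: vpu|].
    by apply: smooth_comp_fst; exact: smooth_translate.
  by move=> z _; rewrite flat_projE /=; apply/esym; exact: orbit_pi_act.
Qed.

(* Takes its values in the small cube times F when possible; arbitrary
   elsewhere. *)
Definition flat_lift (e : M) : 'rV[R]_2 * F :=
  xget (orbit_repr e) [set p | small_cube p.1 /\ pi p = e].

Lemma flat_liftK p : small_cube p.1 -> flat_lift (pi p) = p.
Proof.
case: p => u x /= su; rewrite /flat_lift.
set S := [set _ | _].
have : exists w, S w by exists (u, x).
move=> /(xgetPex (orbit_repr (pi (u, x)))); case: (xget _ _) => w y [/= sw].
by move=> /(@flat_pi_near _ _ _ _ 0)[]; rewrite ?subr0// => -> ->.
Qed.

End Flat.

(** * Topology of the total space *)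

Section Trigonometry.
Variable R : realType.
Implicit Types x y : R.

Lemma periodic_int (f : R -> R) T : periodic f T ->
  forall x (k : int), f (x + k%:~R * T) = f x.
Proof.
move=> fT x [n|n]; first by rewrite -pmulrn mulr_natl periodicn.
by rewrite NegzE -(periodicn fT n.+1) intrN -pmulrn mulNr mulr_natl subrK.
Qed.

(** For the fractional part r in [0, 1[, the double-angle formula turns the hypothesis into sin (pi
    r) = 0, and sin is positive on ]0, pi[. *)
Lemma cos2pi_eq1 x : cos (x * (pi *+ 2)) = 1 -> exists k : int, x = k%:~R.
Proof.
move=> cx; exists (Num.floor x).
have /andP[fx xf] := floor_itv x; rewrite intrD in xf.
pose r := x - (Num.floor x)%:~R.
have r0 : 0 <= r by rewrite /r; lra.
have r1 : r < 1 by rewrite /r; lra.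
have xr : x = r + (Num.floor x)%:~R by rewrite /r subrK.
have : cos ((r * pi) *+ 2) = 1.
  rewrite -mulrnAr -(periodic_int (@cosD2pi R) _ (Num.floor x)).
  by rewrite -mulrDl -xr.
rewrite cos_mulr2n cos2sin2 => sr.
have : sin (r * pi) ^+ 2 = 0 by move: sr; set s := _ ^+ 2; lra.
move=> /eqP; rewrite sqrf_eq0 => /eqP s0.
have [r00|rn0] := eqVneq r 0; first by apply: etrans xr _; rewrite r00 add0r.
have : 0 < sin (r * pi).
  apply: sin_gt0_pi; apply/andP; split.
    by rewrite mulr_gt0 ?pi_gt0// lt_def rn0 r0.
  by rewrite -[ltRHS]mul1r ltr_pM2r// pi_gt0.
by rewrite s0 ltxx.
Qed.

Lemma cos_sin_eq x y : cos x = cos y -> sin x = sin y -> cos (x - y) = 1.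
Proof. by move=> cxy sxy; rewrite cosB cxy sxy -!expr2 cos2Dsin2. Qed.

End Trigonometry.

Lemma cluster_continuous (X Y : topologicalType) (f : X -> Y) x y :
  hausdorff_space Y -> continuous f -> cluster (nbhs x) y -> f x = f y.
Proof.
move=> hY cf xy; apply: hY => A B Afx Bfy.
by have [z [Az Bz]] := xy _ _ (cf x _ Afx) (cf y _ Bfy); exists (f z).
Qed.

Lemma second_countable_prod (X Y : topologicalType) :
  @second_countable X -> @second_countable Y -> @second_countable (X * Y)%type.
Proof.
move=> [A cA [oA bA]] [B cB [oB bB]].
exists ((fun p => p.1 `*` p.2) @` (A `*` B)).
  by apply: sub_countable (countableX cA cB); exact: card_image_le.
split; first by move=> _ [[U V] [/= AU BV] <-]; apply: open_setX; [exact: oA|exact: oB].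
move=> [x y] W [[U V] [/= Ux Vy] UVW].
have [U' [AU' U'x] U'U] := bA x U Ux.
have [V' [BV' V'y] V'V] := bB y V Vy.
exists (U' `*` V'); first by split; [exists (U', V')|].
by move=> [x' y'] [/= U'x' V'y']; apply: UVW; split; [exact: U'U|exact: V'V].
Qed.

Lemma second_countable_open_map (X Y : topologicalType) (q : X -> Y) :
  continuous q -> (forall U, open U -> open (q @` U)) ->
  (forall y, exists x, q x = y) ->
  @second_countable X -> @second_countable Y.
Proof.
move=> cq oq sq [A cA [oA bA]].
exists ((fun U => q @` U) @` A).
  by apply: sub_countable cA; exact: card_image_le.
split; first by move=> _ [U AU <-]; apply: oq; exact: oA.
move=> y W Wy; have [x qx] := sq y; subst y.
have [U [AU Ux] UW] := bA x _ (cq x _ Wy).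
exists (q @` U); first by split; [exists U|exists x].
by move=> _ [z /UW Wqz <-].
Qed.

Lemma second_countable_rV (R : realType) n : @second_countable 'rV[R]_n.
Proof.
pose f (p : 'rV[rat]_n * nat) : set 'rV[R]_n :=
  [set u | `|u - map_mx ratr p.1| < p.2.+1%:R^-1].
exists (range f); first exact: card_le_trans (card_image_le _ _) (countableP _).
split; first by move=> _ [p _ <-]; exact: open_norm_sub.
move=> u V /nbhs_ballP[e /= e0 eV].
(* Half of [e] is spent from [u] to the rational center and half from the center to [w]. *)
have [k ke] := ltr_add_invr (divr_gt0 e0 (ltr0Sn R 1)).
rewrite add0r in ke.
have k0 : 0 < k.+1%:R^-1 :> R by rewrite invr_gt0 ltr0n.
have /choice[q qE] (i : 'I_n) : exists q : rat, `|u ord0 i - ratr q| < k.+1%:R^-1.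
  move: k0; set d := k.+1%:R^-1 => d0.
  have /rat_in_itvoo[q] : u ord0 i - d < u ord0 i + d by lra.
  by rewrite in_itv /= => /andP[q1 q2]; exists q; rewrite ltr_norml; apply/andP; split; lra.
have uq : `|u - map_mx ratr (\row_i q i)| < k.+1%:R^-1.
  by apply: rV_norm_lt => // i; rewrite !mxE.
exists (f (\row_i q i, k)); first by split; [exists (\row_i q i, k)|].
move=> w; rewrite /f /=; move: (map_mx _ _) uq => c uc wc.
apply: eV; rewrite -ball_normE /=.
have -> : u - w = (u - c) - (w - c) by rewrite opprB addrA subrK.
apply: le_lt_trans (ler_normB _ _) _; rewrite [ltRHS]splitr.
apply: ltrD; [exact: lt_trans uc ke|exact: lt_trans wc ke].
Qed.

Section TorusTopology.
Variable R : realType.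

(** Together with [torus_sin], the coordinates of the embedding of the torus in R^4 as a product of
    two unit circles. By periodicity the representative does not matter. *)
Definition torus_cos (i : 'I_2) (b : torus R) : R :=
  cos ((orbit_repr b) ord0 i * (pi *+ 2)).
Definition torus_sin (i : 'I_2) (b : torus R) : R :=
  sin ((orbit_repr b) ord0 i * (pi *+ 2)).

Let reprE (u : 'rV[R]_2) : exists v : 'rV[int]_2,
  forall i, orbit_repr (torus_pi u) ord0 i = u ord0 i + (v ord0 i)%:~R.
Proof.
have /orbit_piP[v vE] := esym (orbit_piK (torus_pi u)).
by exists v => i; rewrite -vE !mxE.
Qed.

Lemma torus_cosE i u : torus_cos i (torus_pi u) = cos (u ord0 i * (pi *+ 2)).
Proof.
have [v vE] := reprE u.
by rewrite /torus_cos vE mulrDl (periodic_int (@cosD2pi R)).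
Qed.

Lemma torus_sinE i u : torus_sin i (torus_pi u) = sin (u ord0 i * (pi *+ 2)).
Proof.
have [v vE] := reprE u.
by rewrite /torus_sin vE mulrDl (periodic_int (@sinD2pi R)).
Qed.

Let coord_mul i (c : R) : continuous (fun u : 'rV[R]_2 => u ord0 i * c).
Proof.
move=> u; apply: (@continuousM _ _ (fun u : 'rV[R]_2 => u ord0 i) (cst c)).
  exact: coord_continuous.
exact: cst_continuous.
Qed.

Lemma torus_cos_continuous i : continuous (torus_cos i).
Proof.
move=> b; have <- := orbit_piK b; apply: open_map_for_continuous.
  exact: torus_pi_open.
have -> : torus_cos i \o orbit_pi (translation R) =
    (@cos R) \o (fun u : 'rV[R]_2 => u ord0 i * (pi *+ 2)).
  by apply/funext => u; exact: torus_cosE.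
by apply: continuous_comp; [exact: coord_mul|exact: continuous_cos].
Qed.

Lemma torus_sin_continuous i : continuous (torus_sin i).
Proof.
move=> b; have <- := orbit_piK b; apply: open_map_for_continuous.
  exact: torus_pi_open.
have -> : torus_sin i \o orbit_pi (translation R) =
    (@sin R) \o (fun u : 'rV[R]_2 => u ord0 i * (pi *+ 2)).
  by apply/funext => u; exact: torus_sinE.
by apply: continuous_comp; [exact: coord_mul|exact: continuous_sin].
Qed.

Lemma torus_pi_eq_trig (u w : 'rV[R]_2) :
  (forall i, cos (u ord0 i * (pi *+ 2)) = cos (w ord0 i * (pi *+ 2))) ->
  (forall i, sin (u ord0 i * (pi *+ 2)) = sin (w ord0 i * (pi *+ 2))) ->
  @torus_pi R u = torus_pi w.
Proof.
move=> cuw suw.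
have /choice[k kE] (i : 'I_2) : exists k : int, w ord0 i - u ord0 i = k%:~R.
  by apply: cos2pi_eq1; rewrite mulrBl; exact: cos_sin_eq.
apply/orbit_piP; exists (\row_i k i); apply/rowP => i.
by rewrite !mxE -kE addrC subrK.
Qed.

(** The continuous functions [torus_cos i] and [torus_sin i] separate points. *)
Lemma torus_hausdorff : hausdorff_space (torus R).
Proof.
move=> b b'; have <- := orbit_piK b; have <- := orbit_piK b' => bb'.
apply: torus_pi_eq_trig => i.
  rewrite -!torus_cosE; apply: (cluster_continuous _ _ bb').
    exact: Rhausdorff.
  exact: torus_cos_continuous.
rewrite -!torus_sinE; apply: (cluster_continuous _ _ bb').
  exact: Rhausdorff.
exact: torus_sin_continuous.
Qed.

End TorusTopology.

Lemma lsubmx_diff (R : realType) n m (a : 'rV[R]_n) (z h : 'rV[R]_(n + m)) :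
  'd ((@lsubmx R 1 n m) + cst a) z h = lsubmx h.
Proof.
have e1 := diffD (differentiable_lsubmx z) (differentiable_cst a z).
have e2 := diff_lin (f := @lsubmx R 1 n m) z (@continuous_lsubmx R 1 n m).
have e3 := diff_cst a z.
apply: etrans (congr1 (@^~ h) e1) _.
exact: etrans (congr2 +%R (congr1 (@^~ h) e2) (congr1 (@^~ h) e3)) (addr0 _).
Qed.

Section FlatTopology.
Variables (R : realType) (F : topologicalType) (AF : set (chart R 2 F)).
Variables (rho : Z2action F).
Hypothesis srho : forall v, smooth AF AF (rho v).
Hypothesis F_closed : closed_manifold AF.

Local Notation M := (flat_total R rho).
Local Notation pi := (@flat_pi R F rho).
Local Notation proj := (flat_proj R rho).
Local Notation P := (prod_atlas (space_atlas R 2) AF).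

Lemma flat_hausdorff : hausdorff_space M.
Proof.
have [[hF _ _] _] := F_closed.
move=> e e' ee'; have [[u x] pe] := flat_pi_surj e; subst e.
have [[w y] pe'] := flat_pi_surj e'; subst e'.
(* Points that cannot be separated have the same projection, since the torus is Hausdorff. Both can
   then be written over [w]; over the cube of radius 1/2 around [w] the map [pi] is injective, which
   leaves the separation to [F]. *)
have : proj (pi (u, x)) = proj (pi (w, y)).
  apply: cluster_continuous ee'; first exact: torus_hausdorff.
  exact: flat_proj_continuous srho.
rewrite !flat_projE => /orbit_piP[v /= vuw].
have -> : pi (u, x) = pi (w, rho v x).
  by rewrite -vuw; apply/flat_piP; exists v.
congr (pi (w, _)); apply: hF => A B Ax By.
have uA : nbhs (pi (u, x)) (pi @` ([set z | `|z - w| < 2^-1] `*` A)).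
  have -> : pi (u, x) = pi (w, rho v x).
    by rewrite -vuw; apply/flat_piP; exists v.
  apply: open_map_nbhs; first exact: flat_pi_open srho.
  exists ([set z | `|z - w| < 2^-1], A) => //; split => //=.
  by apply: nbhs_norm_sub; rewrite invr_gt0 ltr0n.
have wB : nbhs (pi (w, y)) (pi @` ([set z | `|z - w| < 2^-1] `*` B)).
  apply: open_map_nbhs; first exact: flat_pi_open srho.
  exists ([set z | `|z - w| < 2^-1], B) => //; split => //=.
  by apply: nbhs_norm_sub; rewrite invr_gt0 ltr0n.
have [_ [[[z a] [/= zw Aa] <-] [[z' b] [/= z'w Bb]]]] := ee' _ _ uA wB.
by move=> /(flat_pi_near z'w zw)[_ ba]; exists a; split => //; rewrite -ba.
Qed.

Lemma flat_second_countable : @second_countable M.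
Proof.
have [[_ sF _] _] := F_closed.
apply: (@second_countable_open_map _ _ pi).
- exact: flat_pi_continuous.
- exact: flat_pi_open srho.
- exact: flat_pi_surj.
- by apply: second_countable_prod => //; exact: second_countable_rV.
Qed.

Lemma flat_compact : compact [set: M].
Proof.
have [_ kF] := F_closed.
pose Q := [set u : 'rV[R]_2 | forall i, `[0, 1]%classic (u ord0 i)].
have -> : [set: M] = pi @` (Q `*` setT).
  apply/seteqP; split => // e _; have [[u x] <-] := flat_pi_surj e.
  (* Removing the integer parts moves [u] into the closed unit square. *)
  pose v := \row_i (- Num.floor (u ord0 i)) : 'rV[int]_2.
  exists (u + Z2_to_R2 R v, rho v x); last by apply/esym/flat_piP; exists v.
  split => //= i; rewrite !mxE /= in_itv /=.
  have := floor_itv (u ord0 i); rewrite intrD intrN => /andP[? ?].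
  by apply/andP; split; lra.
apply: continuous_compact; first by apply: continuous_subspaceT; exact: flat_pi_continuous.
apply: compact_setX => //.
by apply: (@rV_compact R 2 (fun=> `[0, 1]%classic)) => i; exact: segment_compact.
Qed.

Lemma flat_closed_manifold : closed_manifold (flat_atlas rho AF).
Proof.
split; last exact: flat_compact.
split; [exact: flat_hausdorff|exact: flat_second_countable|].
by apply: flat_smooth_atlas => //; case: F_closed => -[].
Qed.

Lemma flat_submersion e : submersion_at (flat_atlas rho AF) (torus_atlas R) proj e.
Proof.
move=> c d Ac Ad ce de w.
have [p [c0 [W [pe [c1 [b [sc1 Ab c0d c0E]]] [oW Wp] Wc cE]]]] :=
  modelled_quotient Ac ce.
have [u [d0 [W' [ue sd0 [oW' Wu] Wd dE]]]] := modelled_quotient Ad de.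
have : torus_pi p.1 = torus_pi u by rewrite -(flat_projE rho) pe ue.
move=> /orbit_piP[v vpu].
pose N := W `&` (translate v \o fst) @^-1` W'.
have oN : open N.
  apply: openI => //; apply: open_comp => // q _.
  apply: continuous_comp; first exact: cvg_fst.
  exact: translate_continuous.
have oc0N : open (c0 @` N) by apply: chart_open => // q [/Wc].
have ez : c e = c0 p by rewrite -pe (cE p Wp).2.
(* In coordinates the projection is the linear map [lsubmx] followed by the lattice translation [v]
   that reconciles the two local lifts; its differential is therefore [lsubmx], which is onto. *)
have near_eq : \forall z \near c e,
    (@lsubmx R 1 2 2 + cst (Z2_to_R2 R v)) z = (d \o proj \o cinv c) z.
  have : nbhs (c e) (c0 @` N).
    apply: open_nbhs_nbhs; split => //; rewrite ez; exists p => //.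
    by split => //=; move: vpu => /= ->.
  apply: filterS => _ [q [Wq /= W'q] <-].
  have [cq <-] := cE q Wq; rewrite cmapK// flat_projE.
  have -> : torus_pi q.1 = torus_pi (translate v q.1).
    by apply/esym; exact: orbit_pi_act.
  rewrite [RHS](dE _ W'q).2.
  rewrite sd0.2 (cE q Wq).2 !fctE c0E; last exact: Wc.
  by rewrite row_mxKl sc1.2.
have [|_ ->] := near_eq_differentiable near_eq.
  apply: differentiableD; last exact: differentiable_cst.
  exact: differentiable_lsubmx.
by exists (row_mx w 0); apply: etrans (lsubmx_diff _ _ _) _; rewrite row_mxKl.
Qed.

End FlatTopology.

(** * The fiber over the origin and the trivialization *)

Section Cube.
Variable R : realType.

Lemma small_cube_open : open (@small_cube R).
Proof.
have -> : @small_cube R = [set u | `|u - 0| < 2^-1].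
  by apply/seteqP; split => u; rewrite /small_cube /= subr0.
exact: open_norm_sub.
Qed.

Lemma small_cube0 : @small_cube R 0.
Proof. by rewrite /small_cube /= normr0 invr_gt0 ltr0n. Qed.

Definition torus_cube : set (torus R) := @torus_pi R @` @small_cube R.

Lemma torus_cube_open : open torus_cube.
Proof. by apply: torus_pi_open; exact: small_cube_open. Qed.

Lemma torus_pi_cube u w : @small_cube R u -> @small_cube R w ->
  torus_pi u = torus_pi w -> u = w.
Proof. by move=> su sw; apply: (@torus_pi_near _ _ _ 0); rewrite subr0. Qed.

Lemma torus_chart : exists2 d, torus_atlas R d & cdom d = torus_cube /\
  forall u, @small_cube R u -> d (torus_pi u) = u.
Proof.
have [c Ac _] := space_atlas_cover (0 : 'rV[R]_2).
have sc : @small_cube R `<=` cdom c by rewrite Ac.1.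
have [d [dd dE]] := quotient_chart (@torus_pi_continuous R) (@torus_pi_open R)
  small_cube_open sc torus_pi_cube.
exists d; last by split => // u su; rewrite dE// Ac.2.
exists c, (@small_cube R); split; [|exact: sc|exact: torus_pi_cube|exact: dd|exact: dE].
by split => //; exact: small_cube_open.
Qed.

(** The interior point makes the preimage of [D] a neighborhood of a fiber; the inclusion in
    [torus_cube] is what the trivialization uses. *)
Lemma torus_disk : exists D b, [/\ closed_disk (torus_atlas R) D, interior D b
  & D `<=` torus_cube].
Proof.
have [d Ad [dd dE]] := torus_chart.
(* Radius 1/4 keeps the Euclidean disk inside the open cube of sup-norm radius 1/2. *)
pose disk := [set u : 'rV[R]_2 |
  \sum_(i < 2) (u ord0 i - (0 : 'rV[R]_2) ord0 i) ^+ 2 <= (4^-1 : R) ^+ 2].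
exists (cdom d `&` d @^-1` disk), (torus_pi 0); split; last by rewrite dd => b [].
- exists d, 0, 4^-1; split => //.
  + by move=> e Ae; apply: (torus_smooth_atlas R).2.
  + move=> u /= du.
    have su : @small_cube R u.
      apply: rV_norm_lt => [|i]; first by rewrite invr_gt0 ltr0n.
      move: du; rewrite (bigD1 i)//= mxE subr0.
      set s := \sum_(_ < _ | _) _ => us.
      have s0 : 0 <= s by apply: sumr_ge0 => j _; exact: sqr_ge0.
      have u4 : u ord0 i ^+ 2 < (2^-1) ^+ 2 by lra.
      by rewrite -ltr_sqr ?nnegrE ?invr_ge0 ?ler0n// real_normK ?num_real.
    by exists (torus_pi u); [rewrite dd; exists u|exact: dE].
(* The sup-norm ball of radius 1/8 lies in the disk: two squares bounded by 1/64 add up to at most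
   1/32, less than 1/16. *)
- apply: (@filterS _ _ _ (@torus_pi R @` [set u | `|u - 0| < 8^-1])).
    move=> _ [u /= + <-]; rewrite subr0 => u8.
    have su : small_cube u by rewrite /small_cube /=; lra.
    split; first by rewrite dd; exists u.
    have ui i : u ord0 i ^+ 2 <= (8^-1 : R) ^+ 2.
      rewrite -real_normK ?num_real// ler_sqr ?nnegrE ?invr_ge0 ?ler0n//.
      exact: le_trans (coord_le_norm _ _) (ltW u8).
    rewrite /= dE// /disk /= !big_ord_recl big_ord0 !mxE !subr0 addr0.
    have := ui ord0; have := ui (lift ord0 ord0).
    by move: (u _ _ ^+ 2) (u _ _ ^+ 2) => a b; lra.
  apply: open_map_nbhs; first exact: torus_pi_open.
  by apply: nbhs_norm_sub; rewrite invr_gt0 ltr0n.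
Qed.

End Cube.

Section Fiber.
Variables (R : realType) (F : topologicalType) (AF : set (chart R 2 F)).
Variables (rho : Z2action F).
Hypothesis srho : forall v, smooth AF AF (rho v).
Hypothesis F_closed : closed_manifold AF.

Local Notation M := (flat_total R rho).
Local Notation pi := (@flat_pi R F rho).
Local Notation proj := (flat_proj R rho).
Local Notation P := (prod_atlas (space_atlas R 2) AF).
Local Notation cube := (@small_cube R).

Lemma flat_lift_continuous p : cube p.1 ->
  {for (pi p), continuous (@flat_lift R F rho)}.
Proof.
move=> sp; apply: open_map_for_continuous; first exact: flat_pi_open srho.
apply: (@near_eq_for_continuous _ _ _ id); last exact: cvg_id.
have : nbhs p (cube `*` setT).
  apply: open_nbhs_nbhs; split; last by split.
  by apply: open_setX; [exact: small_cube_open|exact: openT].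
by apply: filterS => q [sq _]; rewrite /= flat_liftK.
Qed.

Lemma flat_cube e u : proj e = torus_pi u -> exists x, e = pi (u, x).
Proof.
have [[w y] <-] := flat_pi_surj e; rewrite flat_projE => /orbit_piP[v <-].
by exists (rho v y); apply/flat_piP; exists v.
Qed.

Lemma flat_cube_chart b : AF b -> exists2 e, flat_atlas rho AF e &
  cdom e = pi @` (cube `*` cdom b) /\
  forall u x, cube u -> cdom b x -> e (pi (u, x)) = row_mx u (b x).
Proof.
move=> Ab; have [c Ac _] := space_atlas_cover (0 : 'rV[R]_2).
have [d [dd dE]] := prod_chart c b.
have oW : open (cube `*` cdom b).
  by apply: open_setX; [exact: small_cube_open|exact: cdom_open].
have Wd : cube `*` cdom b `<=` cdom d by move=> p [_ bp]; rewrite dd Ac.1.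
have Wi p q : (cube `*` cdom b) p -> (cube `*` cdom b) q -> pi p = pi q -> p = q.
  case: p q => [u x] [w y] [/= su _] [/= sw _].
  by move=> /(flat_pi_near (c := 0))[]; rewrite ?subr0// => -> ->.
have [e [ed eE]] := quotient_chart (@flat_pi_continuous _ _ rho)
  (flat_pi_open srho) oW Wd Wi.
exists e; last first.
  by split => // u x su bx; rewrite eE// dE /= Ac.2.
exists d, (cube `*` cdom b); split; [|exact: Wd|exact: Wi|exact: ed|exact: eE].
by split => //; exists c, b; split.
Qed.

Definition zero_fiber : set M := proj @^-1` [set torus_pi 0].

Lemma zero_fiberP e : zero_fiber e <-> exists x, e = pi (0, x).
Proof.
split => [/flat_cube[x ->]|[x ->]]; first by exists x.
by rewrite /zero_fiber /= flat_projE.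
Qed.

(** A point of the fiber over the origin has its first coordinate in the lattice, and the small cube
    contains no lattice point but 0. *)
Lemma flat_slice_chart b e : AF b -> flat_atlas rho AF e ->
  cdom e = pi @` (cube `*` cdom b) ->
  (forall u x, cube u -> cdom b x -> e (pi (u, x)) = row_mx u (b x)) ->
  @slice_chart R 2 2 M (flat_atlas rho AF) zero_fiber e.
Proof.
move=> Ab Ae ed eE; split.
  have [_ comp] : smooth_atlas (flat_atlas rho AF).
    by apply: flat_smooth_atlas => //; case: F_closed => -[].
  by move=> d Ad; exact: comp.
rewrite ed => _ [[u x] [/= su bx] <-]; rewrite eE// row_mxKl.
rewrite /zero_fiber /= flat_projE /=; split => [|->//].
by apply: torus_pi_cube => //; exact: small_cube0.
Qed.

Let AF_cover x : exists2 b, AF b & cdom b x.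
Proof. by case: F_closed => -[_ _ [cAF _]] _; exact: cAF. Qed.

Lemma zero_fiber_embedded : @embedded_submanifold R 2 2 M (flat_atlas rho AF) zero_fiber.
Proof.
move=> _ /zero_fiberP[x ->]; have [b Ab bx] := AF_cover x.
have [e Ae [ed eE]] := flat_cube_chart Ab.
exists e; first exact: flat_slice_chart eE.
by rewrite ed; exists (0, x) => //; split => //; exact: small_cube0.
Qed.

Let incl0_continuous : continuous (fun x => pi (0, x)).
Proof.
move=> x; apply: (@continuous_comp _ _ _ (fun y : F => (0 : 'rV[R]_2, y)) pi);
  last exact: flat_pi_continuous.
by apply: pair_for_continuous; [exact: cst_continuous|exact: cvg_id].
Qed.

Lemma zero_fiber_compact : compact zero_fiber.
Proof.
have -> : zero_fiber = (fun x => pi (0, x)) @` setT.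
  apply/seteqP; split => [_ /zero_fiberP[x ->]|_ [x _ <-]]; first by exists x.
  by apply/zero_fiberP; exists x.
apply: continuous_compact; first exact: continuous_subspaceT.
by case: F_closed.
Qed.

Definition fiber_incl (x : F) : set_type zero_fiber :=
  exist (fun e => e \in zero_fiber) (pi (0, x))
    (mem_set ((zero_fiberP _).2 (ex_intro _ x erefl))).

Definition fiber_proj (k : set_type zero_fiber) : F := (flat_lift (set_val k)).2.

Lemma fiber_inclE x : set_val (fiber_incl x) = pi (0, x).
Proof. by []. Qed.

Lemma fiber_inclK : cancel fiber_incl fiber_proj.
Proof.
by move=> x; rewrite /fiber_proj fiber_inclE flat_liftK//; exact: small_cube0.
Qed.

Lemma fiber_projK : cancel fiber_proj fiber_incl.
Proof.
move=> k; apply: val_inj => /=; have /set_mem/zero_fiberP[x kx] := valP k.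
by rewrite /fiber_proj set_valE /= [val k]kx flat_liftK//; exact: small_cube0.
Qed.

Lemma fiber_incl_continuous : continuous fiber_incl.
Proof.
apply: (@continuous_comp_initial _ _ _ set_val).
exact: incl0_continuous.
Qed.

Lemma fiber_proj_continuous : continuous fiber_proj.
Proof.
move=> k; have <- := fiber_projK k; move: (fiber_proj k) => x.
apply: (@continuous_comp _ _ _ (fun k => flat_lift (set_val k)) snd); last exact: cvg_snd.
apply: (@continuous_comp _ _ _ set_val (@flat_lift R F rho)).
  exact: initial_continuous.
by apply: flat_lift_continuous; exact: small_cube0.
Qed.

Lemma fiber_diffeomorphism : diffeomorphism AF
  (@submanifold_atlas R 2 2 M (flat_atlas rho AF) zero_fiber) fiber_incl.
Proof.
split; last (exists fiber_proj; split; [|exact: fiber_inclK|exact: fiber_projK]).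
all: split; [move=> x _|].
all: try by [exact: fiber_incl_continuous|exact: fiber_proj_continuous].
- move=> b e Ab [c [[smc slc] ed eE]].
  (* The slice chart [c] is arbitrary, so it is compared with the explicit chart [e0]: the inclusion
     reads as the smooth transition [c \o cinv e0] between the linear maps [inrmx] and [rsubmx]. *)
  have [e0 Ae0 [e0d e0E]] := flat_cube_chart Ab.
  have [_ sc] := smc e0 Ae0.
  have oU : open (e0 @` (cdom c `&` cdom e0)).
    by apply: chart_open => [|x []//]; apply: openI; exact: cdom_open.
  have := Cinfty_comp_linearr oU (@inrmx_continuous R 2 2) sc.
  have oU' : open (@inrmx R 2 2 @^-1` (e0 @` (cdom c `&` cdom e0))).
    by apply: open_comp => // x _; exact: inrmx_continuous.
  move=> /(Cinfty_comp_linearl oU' (@continuous_rsubmx R 1 2 2)) H.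
  apply: Cinfty_local => _ [x [[_ bx] ex] <-].
  exists (b @` (cdom b `&` fiber_incl @^-1` cdom e)).
  exists (fun z => rsubmx ((c \o cinv e0) (inrmx 2 z))).
  have oE : open (fiber_incl @^-1` cdom e).
    by apply: open_comp; [move=> y _; exact: fiber_incl_continuous|exact: cdom_open].
  have key y : cdom b y -> cdom e (fiber_incl y) ->
      [/\ cdom c (pi (0, y)), cdom e0 (pi (0, y)) &
          e0 (pi (0, y)) = inrmx 2 (b y)].
    move=> by_ ey; split; first by move: ey; rewrite ed.
      by rewrite e0d; exists (0, y) => //; split => //; exact: small_cube0.
    by rewrite e0E//; exact: small_cube0.
  split.
  + by apply: chart_open => [|y []//]; apply: openI => //; exact: cdom_open.
  + by exists x.
  + apply: Cinfty_subset H => _ [y [by_ ey] <-] /=.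
    have [cy e0y <-] := key y by_ ey.
    by exists (pi (0, y)).
  + move=> _ [y [by_ ey] <-] /=; have [cy e0y e0yE] := key y by_ ey.
    by rewrite -e0yE cmapK// cmapK// eE.
- move=> e b [c [[smc slc] ed eE]] Ab.
  have [e0 Ae0 [e0d e0E]] := flat_cube_chart Ab.
  have [sc _] := smc e0 Ae0.
  have oU : open (c @` (cdom c `&` cdom e0)).
    by apply: chart_open => [|x []//]; apply: openI; exact: cdom_open.
  have := Cinfty_comp_linearr oU (@inrmx_continuous R 2 2) sc.
  have oU' : open (@inrmx R 2 2 @^-1` (c @` (cdom c `&` cdom e0))).
    by apply: open_comp => // x _; exact: inrmx_continuous.
  move=> /(Cinfty_comp_linearl oU' (@continuous_rsubmx R 1 2 2)) H.
  apply: Cinfty_local => _ [k [[_ ek] bk] <-].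
  exists (e @` (cdom e `&` fiber_proj @^-1` cdom b)).
  exists (fun z => rsubmx ((e0 \o cinv c) (inrmx 2 z))).
  have oE : open (fiber_proj @^-1` cdom b).
    by apply: open_comp; [move=> y _; exact: fiber_proj_continuous|exact: cdom_open].
  have key l : cdom e l -> cdom b (fiber_proj l) ->
      [/\ cdom c (set_val l), cdom e0 (set_val l),
          c (set_val l) = inrmx 2 (e l) & e0 (set_val l) = row_mx 0 (b (fiber_proj l))].
    move=> el bl; have cl : cdom c (set_val l) by move: el; rewrite ed.
    have lE : set_val l = pi (0, fiber_proj l) by rewrite -fiber_inclE fiber_projK.
    split => //.
    + by rewrite e0d lE; exists (0, fiber_proj l) => //; split => //; exact: small_cube0.
    + rewrite eE// -[LHS]hsubmxK; congr row_mx.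
      (* The slice condition makes the normal coordinates of [c] vanish on the fiber, so [inrmx]
         recovers the full coordinates from those of [e]. *)
      by apply/(slc _ cl)/zero_fiberP; exists (fiber_proj l).
    + by rewrite lE e0E//; exact: small_cube0.
  split.
  + by apply: chart_open => [|y []//]; apply: openI => //; exact: cdom_open.
  + by exists k.
  + apply: Cinfty_subset H => _ [l [el bl] <-] /=.
    have [cl e0l <- _] := key l el bl.
    by exists (set_val l).
  + move=> _ [l [el bl] <-] /=; have [cl e0l cE e0lE] := key l el bl.
    by rewrite -cE cmapK// e0lE row_mxKr cmapK.
Qed.

(** The point [x] makes the fiber nonempty, so that its image is a singleton. *)
Lemma flat_collapse (x : F) :
  surface_collapse AF (flat_atlas rho AF) zero_fiber proj.
Proof.
split.
- exact: flat_closed_manifold.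
- split; [exact: zero_fiber_embedded|exact: zero_fiber_compact|].
  by exists fiber_incl; exact: fiber_diffeomorphism.
- exact: flat_proj_smooth.
- exists (torus_pi 0); apply/seteqP; split => [_ [e Ke <-]//|_ ->].
  by exists (pi (0, x)); [apply/zero_fiberP; exists x|rewrite flat_projE].
- by move=> e _; exact: flat_submersion.
Qed.

Lemma flat_trivialized (D : set (torus R)) : D `<=` @torus_cube R ->
  trivialized_over (flat_atlas rho AF) (torus_atlas R) AF proj D.
Proof.
(* Both maps come from the sections over the small cube and take arbitrary values off [torus_cube];
   this is why smoothness is tested on open sets over the cube. *)
move=> DT; exists (fun p => pi (torus_lift p.1, p.2)), (fun e => (flat_lift e).2).
split.
- move=> [b x] [/= Db _]; exists (@torus_cube R `*` setT).
  exists (fun p => pi (torus_lift p.1, p.2)); split => //.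
  + by apply: open_setX; [exact: torus_cube_open|exact: openT].
  + by split => //; exact: DT.
  apply: (@smooth_modelled R _ _ _ _ _ _ P _
    (fun p => (@torus_pi R p.1, p.2)) P _ pi).
  + apply: (modelled_prod (q' := id)); first exact: modelled_quotient.
    exact: modelled_id.
  + exact: modelled_quotient.
  + apply: (open_map_prod (r := id)); first exact: torus_pi_open.
    by move=> U; rewrite image_id.
  + exact: flat_pi_continuous.
  + by move=> [c y]; exists (orbit_repr c, y); rewrite /= [torus_pi _]orbit_piK.
  + exact: flat_pi_surj.
  + move=> [w y] [w' y'] [/= [u su uw] _] /=; rewrite -uw torus_liftK//.
    move=> /flat_piP[v [uvw' vyy']].
    (* The lift [w] of a point of [torus_cube] need not be in the small cube: [v'] brings it there,
       to [u]. On the source only the torus factor is a quotient, so [v'] acts by translation alone;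
       [v] comes from the total space and also acts on [F] by [rho v]. *)
    have /orbit_piP[v' vwu] := esym uw.
    exists ([set z | cube (translate v' z)] `*` setT).
    exists (fun p => (translate (v + v') p.1, rho v p.2)); split.
    * apply: open_setX; last exact: openT.
      apply: open_comp; last exact: small_cube_open.
      by move=> z _; exact: translate_continuous.
    * by split => //=; move: vwu => /= ->.
    * by apply: smooth_prod_map => //; exact: smooth_translate.
    * by move: vwu => /= <- in uvw'; rewrite translateD /= vyy' -uvw'.
    * move=> [z t] [/= cz _].
      have -> : torus_pi z = torus_pi (translate v' z).
        by apply/esym; exact: orbit_pi_act.
      by rewrite torus_liftK// translateD; apply/flat_piP; exists v.
- move=> e /= De; exists (proj @^-1` @torus_cube R), (fun e => (flat_lift e).2).
  split => //.
  + apply: open_comp; last exact: torus_cube_open.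
    by move=> z _; exact: flat_proj_continuous srho _.
  + exact: DT.
  apply: (@smooth_modelled R _ _ _ _ _ _ P _ pi AF _ id).
  + exact: modelled_quotient.
  + exact: modelled_id.
  + exact: flat_pi_open srho.
  + by move=> x; exact: cvg_id.
  + exact: flat_pi_surj.
  + by move=> y; exists y.
  + move=> [w y] x; rewrite /= flat_projE => -[u su uw].
    (* Bringing [w] into the small cube by [v] applies [rho v] to the fiber coordinate, so
       [rho v \o snd] is the local lift. *)
    have /orbit_piP[v vwu] := esym uw.
    have E z t : cube (translate v z) -> (flat_lift (pi (z, t))).2 = rho v t.
      move=> cz; have -> : pi (z, t) = pi (translate v z, rho v t).
        by apply/flat_piP; exists v.
      by rewrite flat_liftK.
    move: vwu => /= vwu.
    rewrite E ?vwu// => vyx.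
    exists ([set z | cube (translate v z)] `*` setT), (rho v \o snd); split => //.
    * apply: open_setX; last exact: openT.
      apply: open_comp; last exact: small_cube_open.
      by move=> z _; exact: translate_continuous.
    * by split => //=; rewrite vwu.
    * exact: smooth_comp_snd.
    * by move=> [z t] [/= cz _]; rewrite E.
- move=> b x /DT[u su <-] /=.
  by rewrite torus_liftK// flat_projE flat_liftK.
- move=> e De; have [u su pe] := DT _ De.
  have [x ->] := flat_cube (esym pe).
  by rewrite flat_liftK//= flat_projE torus_liftK.
Qed.

End Fiber.

(** * The fundamental groupoid *)

Lemma mul_isomorphic_sym (G H : Type) (mulG : G -> G -> G) (mulH : H -> H -> H) :
  mul_isomorphic mulG mulH -> mul_isomorphic mulH mulG.
Proof.
move=> [h [g hK gK] hM]; exists g; first by exists h.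
by move=> a b; rewrite -{1}(gK a) -{1}(gK b) -hM hK.
Qed.

Lemma mul_isomorphic_trans (G H K : Type) (mulG : G -> G -> G)
    (mulH : H -> H -> H) (mulK : K -> K -> K) :
  mul_isomorphic mulG mulH -> mul_isomorphic mulH mulK ->
  mul_isomorphic mulG mulK.
Proof.
move=> [h hb hM] [g gb gM]; exists (g \o h); first exact: bij_comp.
by move=> a b; rewrite /= hM gM.
Qed.

Section Paths.
Variables (R : realType) (X : topologicalType).
Local Notation I := (unit_interval R).

Lemma clamp_le0 (r : R) : r <= 0 -> clamp r = clamp 0.
Proof.
move=> r0; apply: val_inj; rewrite /= /clamp_fun.
have r1 : r <= 1 by lra.
by rewrite (min_idPr r1) (min_idPr (@ler01 R)) (max_idPl r0) maxxx.
Qed.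

Lemma clamp_ge1 (r : R) : 1 <= r -> clamp r = clamp 1.
Proof.
by move=> r1; apply: val_inj; rewrite /= /clamp_fun (min_idPl r1) minxx.
Qed.

Lemma ival0 : ival (zero : I) = 0.
Proof. by rewrite /zero /= clampK// lexx ler01. Qed.

Lemma ival1 : ival (one : I) = 1.
Proof. by rewrite /one /= clampK// lexx ler01. Qed.

Lemma ival_clamp_le (r : R) : 0 <= r -> r <= 1 -> ival (clamp r) = r.
Proof. by move=> r0 r1; rewrite clampK// r0. Qed.

Lemma concatE (x y z : X) (p : {path I from x to y}) (q : {path I from y to z}) (t : I) :
  concat p q t =
  if ival t <= 2^-1 then p (clamp (2 * ival t)) else q (clamp (2 * ival t - 1)).
Proof. by []. Qed.

(** The common source of the unit, inverse and associativity laws: two parametrizations of one [f]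
    with the same ends are joined by straight lines. Clamping allows [phi] and [psi] to be
    real-valued without bounds. *)
Lemma path_homotopic_reparam (x y : X) (p q : {path I from x to y}) (f : I -> X)
    (phi psi : I -> R) : continuous f -> continuous phi -> continuous psi ->
  phi zero = psi zero -> phi one = psi one ->
  (forall t, p t = f (clamp (phi t))) -> (forall t, q t = f (clamp (psi t))) ->
  path_homotopic p q.
Proof.
move=> cf cphi cpsi e0 e1 pE qE; apply/asboolP.
exists (fun ts => f (clamp (phi ts.1 + ival ts.2 * (psi ts.1 - phi ts.1)))).
split.
- move=> ts.
  apply: (@continuous_comp _ _ _ (fun ts : I * I =>
    phi ts.1 + ival ts.2 * (psi ts.1 - phi ts.1)) (f \o @clamp R)); last first.
    by apply: continuous_comp; [exact: clamp_cts|exact: cf].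
  have c1 (g : I -> R) : continuous g -> {for ts, continuous (fun ts : I * I => g ts.1)}.
    by move=> cg; apply: (@continuous_comp _ _ _ fst g); [exact: cvg_fst|exact: cg].
  apply: (@continuousD _ _ _ (fun ts : I * I => phi ts.1)); first exact: c1.
  apply: (@continuousM _ _ (fun ts : I * I => ival ts.2)).
    by apply: (@continuous_comp _ _ _ snd (@ival R)); [exact: cvg_snd|exact: ival_cts].
  by apply: (@continuousB _ _ _ (fun ts : I * I => psi ts.1)); exact: c1.
- move=> t /=; rewrite ival0 ival1 mul0r addr0 mul1r addrC subrK.
  by rewrite pE qE.
- move=> s /=; rewrite e0 e1 !subrr !mulr0 !addr0 -!qE.
  by rewrite path_zero path_one.
Qed.

Lemma concat_homotopic (x y z : X) (p p' : {path I from x to y})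
    (q q' : {path I from y to z}) : path_homotopic p p' -> path_homotopic q q' ->
  path_homotopic (concat p q) (concat p' q').
Proof.
move=> /asboolP[H [cH Hp Hxy]] /asboolP[G [cG Gq Gyz]]; apply/asboolP.
have cresc (c : R) : continuous
    (fun ts : I * I => (clamp (2 * ival ts.1 - c), ts.2)).
  apply: pair_cts => ts; last exact: cvg_snd.
  apply: (@continuous_comp _ _ _ fst (fun s : I => clamp (2 * ival s - c))).
    exact: cvg_fst.
  exact: rescale_cts.
exists (fun ts => if ival ts.1 <= 2^-1
  then H (clamp (2 * ival ts.1 - 0), ts.2)
  else G (clamp (2 * ival ts.1 - 1), ts.2)); split.
- apply: glue_cts.
  + by move=> ts; apply: continuous_comp; [exact: cvg_fst|exact: ival_cts].
  + by move=> ts; apply: continuous_comp; [exact: cresc|exact: cH].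
  + by move=> ts; apply: continuous_comp; [exact: cresc|exact: cG].
  + move=> [t s] /= ->; rewrite divff ?pnatr_eq0// subrr subr0.
    by have [_ ->] := Hxy s; have [-> _] := Gyz s.
- move=> t /=; rewrite !concatE subr0; case: ifP => _.
    by have [-> ->] := Hp (clamp (2 * ival t)).
  by have [-> ->] := Gq (clamp (2 * ival t - 1)).
- move=> s /=; rewrite ival0 ival1.
  have -> : (0 : R) <= 2^-1 by lra.
  have -> : ((1 : R) <= 2^-1) = false by apply/negbTE; rewrite -ltNge; lra.
  rewrite mulr0 subr0 mulr1 (_ : 2 - 1 = 1 :> R); last by lra.
  by have [-> _] := Hxy s; have [_ ->] := Gyz s.
Qed.

Definition const_path (x : X) : {path I from x to x} :=
  mk_path (@cst_continuous _ _ x) (erefl x) (erefl x).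

Section Reverse.
Variables (x y : X) (p : {path I from x to y}).

Let rev_fun (t : I) : X := p (clamp (1 - ival t)).

Let rev_cts : continuous rev_fun.
Proof.
move=> t; apply: (@continuous_comp _ _ _ (fun t : I => 1 - ival t) (p \o @clamp R)).
  by apply: continuousB; [exact: cst_continuous|exact: ival_cts].
by apply: continuous_comp; [exact: clamp_cts|exact: cts_fun].
Qed.

Let rev_zero : rev_fun zero = y.
Proof. by rewrite /rev_fun ival0 subr0 path_one. Qed.

Let rev_one : rev_fun one = x.
Proof. by rewrite /rev_fun ival1 subrr path_zero. Qed.

Definition reverse_path : {path I from y to x} := mk_path rev_cts rev_zero rev_one.

Lemma reverse_pathE t : reverse_path t = p (clamp (1 - ival t)).
Proof. by []. Qed.

End Reverse.

Lemma reverse_pathK (x y : X) (p : {path I from x to y}) : reverse_path (reverse_path p) = p.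
Proof.
apply/path_eqP => t; rewrite !reverse_pathE; have /andP[t0 t1] := ivalP t.
rewrite ival_clamp_le; [|lra..].
have -> : 1 - (1 - ival t) = ival t by lra.
by rewrite ivalK.
Qed.

Let rescale_ival_cts (c : R) :
  continuous (fun t : I => ival (clamp (2 * ival t - c))).
Proof.
move=> t.
apply: (@continuous_comp _ _ _ (fun t : I => clamp (2 * ival t - c)) (@ival R)).
  exact: rescale_cts.
exact: ival_cts.
Qed.

Let min_cts (f g : I -> R) : continuous f -> continuous g ->
  continuous (fun t => Num.min (f t) (g t)).
Proof.
by move=> cf cg t; apply: (@continuous_min _ _ f g t); [exact: cf|exact: cg].
Qed.

Let sub_cts (f : I -> R) (c : R) : continuous f -> continuous (fun t => c - f t).
Proof.
move=> cf t; apply: (@continuousB _ _ _ (fun=> c) f t); last exact: cf.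
exact: cst_continuous.
Qed.

Let add_cts (f : I -> R) (c : R) : continuous f -> continuous (fun t => f t + c).
Proof.
move=> cf t; apply: (@continuousD _ _ _ f (fun=> c) t); first exact: cf.
exact: cst_continuous.
Qed.

Let mul_cts (f : I -> R) (c : R) : continuous f -> continuous (fun t => c * f t).
Proof.
move=> cf t; apply: (@continuousM _ _ (fun=> c) f t); last exact: cf.
exact: cst_continuous.
Qed.

Lemma concat_constl (x y : X) (p : {path I from x to y}) :
  path_homotopic (concat (const_path x) p) p.
Proof.
(* Clamped at 0, the parameter 2t - 1 waits at the start of [p] during the first half. *)
apply: (@path_homotopic_reparam _ _ _ _ p
  (fun t => ival (clamp (2 * ival t - 1))) (@ival R)).
- exact: cts_fun.
- exact: rescale_ival_cts.
- exact: ival_cts.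
- by rewrite ival0 clamp_le0; [rewrite ival_clamp_le; lra|lra].
- by rewrite ival1 ival_clamp_le; lra.
- move=> t; rewrite concatE ivalK; case: ifP => // t2.
  rewrite [in RHS]clamp_le0; last by lra.
  exact: esym (path_zero (s := p)).
- by move=> t; rewrite ivalK.
Qed.

Lemma concat_constr (x y : X) (p : {path I from x to y}) :
  path_homotopic (concat p (const_path y)) p.
Proof.
apply: (@path_homotopic_reparam _ _ _ _ p
  (fun t => ival (clamp (2 * ival t - 0))) (@ival R)).
- exact: cts_fun.
- exact: rescale_ival_cts.
- exact: ival_cts.
- by rewrite ival0 ival_clamp_le; lra.
- by rewrite ival1 clamp_ge1; [rewrite ival_clamp_le; lra|lra].
- move=> t; rewrite concatE ivalK subr0; case: ifP => // t2.
  rewrite [in RHS]clamp_ge1; last by move: t2 => /negbT; rewrite -ltNge; lra.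
  exact: esym (path_one (s := p)).
- by move=> t; rewrite ivalK.
Qed.

Lemma concat_revr (x y : X) (p : {path I from x to y}) :
  path_homotopic (concat p (reverse_path p)) (const_path x).
Proof.
(* Going along [p] and back reads [p] along a tent function, which is contracted to 0. *)
apply: (@path_homotopic_reparam _ _ _ _ p
  (fun t => Num.min (2 * ival t) (2 - 2 * ival t)) (cst 0)).
- exact: cts_fun.
- by apply: min_cts; [|apply: sub_cts]; apply: mul_cts; exact: ival_cts.
- exact: cst_continuous.
- by rewrite ival0 /cst /= min_l; lra.
- by rewrite ival1 /cst /= min_r; lra.
- move=> t; rewrite concatE; have /andP[t0 t1] := ivalP t.
  case: ifP => t2; first by rewrite min_l//; lra.
  move: t2 => /negbT; rewrite -ltNge => t2.
  rewrite reverse_pathE ival_clamp_le; [|lra..].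
  by rewrite min_r; [congr (p (clamp _)); lra|lra].
- by move=> t; rewrite [RHS]path_zero.
Qed.

Lemma concat_revl (x y : X) (p : {path I from x to y}) :
  path_homotopic (concat (reverse_path p) p) (const_path y).
Proof. by have := concat_revr (reverse_path p); rewrite reverse_pathK. Qed.

Lemma concatA (x y z w : X) (p : {path I from x to y}) (q : {path I from y to z})
    (r : {path I from z to w}) :
  path_homotopic (concat (concat p q) r) (concat p (concat q r)).
Proof.
(* The change of parameter carries 0, 1/4, 1/2, 1 to 0, 1/2, 3/4, 1. Its slopes 2, 1, 1/2 decrease,
   so it is the minimum of its three affine pieces. *)
pose phi (t : I) := Num.min (2 * ival t)
  (Num.min (ival t + 4^-1) (2^-1 * (ival t + 1))).
apply: (@path_homotopic_reparam _ _ _ _ (concat p (concat q r)) phi (@ival R)).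
- exact: cts_fun.
- apply: min_cts; first by apply: mul_cts; exact: ival_cts.
  apply: min_cts; first by apply: add_cts; exact: ival_cts.
  by apply: mul_cts; apply: add_cts; exact: ival_cts.
- exact: ival_cts.
- by rewrite /phi ival0 min_l ?le_min; lra.
- by rewrite /phi ival1 min_r ?min_r ?ge_min; lra.
- move=> t; have /andP[t0 t1] := ivalP t; rewrite !concatE.
  have [t2|t2] := leP (ival t) 2^-1; last first.
    have -> : phi t = 2^-1 * (ival t + 1).
      by rewrite /phi [X in Num.min _ X]min_r ?min_r; lra.
    rewrite !ival_clamp_le; [|lra..].
    rewrite ifF; last by apply/negbTE; rewrite -ltNge; lra.
    rewrite ifF; last by apply/negbTE; rewrite -ltNge; lra.
    by congr (r (clamp _)); lra.
  rewrite !(@ival_clamp_le (2 * ival t)); [|lra..].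
  have [t4|t4] := leP (2 * ival t) 2^-1.
    have -> : phi t = 2 * ival t by rewrite /phi min_l ?le_min//; lra.
    by rewrite ival_clamp_le; [|lra..]; rewrite ifT//; lra.
  have -> : phi t = ival t + 4^-1.
    by rewrite /phi [X in Num.min _ X]min_l ?min_r; lra.
  rewrite !ival_clamp_le; [|lra..].
  rewrite ifF; last by apply/negbTE; rewrite -ltNge; lra.
  rewrite ifT; last by lra.
  by congr (q (clamp _)); lra.
- by move=> t; rewrite ivalK.
Qed.

End Paths.

Local Open Scope quotient_scope.

Section Groupoid.
Variables (R : realType) (X : topologicalType).
Local Notation I := (unit_interval R).

(** For equal endpoints this is [pi1] by conversion; distinct endpoints serve to change the base
    point. *)
Definition hclass (x y : X) : Type := {eq_quot @path_homotopic_equiv R X x y}.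

Definition hclass_of (x y : X) (p : {path I from x to y}) : hclass x y :=
  \pi_({eq_quot @path_homotopic_equiv R X x y}) p.

Definition hclass_repr (x y : X) (a : hclass x y) : {path I from x to y} :=
  repr (a : {eq_quot @path_homotopic_equiv R X x y}).

Definition hclass_mul (x y z : X) (a : hclass x y) (b : hclass y z) :
  hclass x z := hclass_of (concat (hclass_repr a) (hclass_repr b)).

Lemma hclass_reprK (x y : X) (a : hclass x y) : hclass_of (hclass_repr a) = a.
Proof. exact: reprK. Qed.

Lemma hclass_eq (x y : X) (p q : {path I from x to y}) :
  path_homotopic p q <-> hclass_of p = hclass_of q.
Proof. by split => [h|/eqmodP]; [apply/eqmodP|]. Qed.

Lemma hclass_reprP (x y : X) (p : {path I from x to y}) :
  path_homotopic (hclass_repr (hclass_of p)) p.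
Proof. by apply/hclass_eq; rewrite hclass_reprK. Qed.

Lemma hclass_mulE (x y z : X) (p : {path I from x to y}) (q : {path I from y to z}) :
  hclass_mul (hclass_of p) (hclass_of q) = hclass_of (concat p q).
Proof. by apply/hclass_eq; apply: concat_homotopic; exact: hclass_reprP. Qed.

Lemma hclass_mulA (x y z w : X) (a : hclass x y) (b : hclass y z)
    (c : hclass z w) :
  hclass_mul (hclass_mul a b) c = hclass_mul a (hclass_mul b c).
Proof.
rewrite -(hclass_reprK a) -(hclass_reprK b) -(hclass_reprK c) !hclass_mulE.
by apply/hclass_eq; exact: concatA.
Qed.

Definition hclass_one (x : X) : hclass x x := hclass_of (const_path R x).

Lemma hclass_mul1l (x y : X) (a : hclass x y) : hclass_mul (hclass_one x) a = a.
Proof.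
by rewrite -(hclass_reprK a) hclass_mulE; apply/hclass_eq; exact: concat_constl.
Qed.

Lemma hclass_mul1r (x y : X) (a : hclass x y) : hclass_mul a (hclass_one y) = a.
Proof.
by rewrite -(hclass_reprK a) hclass_mulE; apply/hclass_eq; exact: concat_constr.
Qed.

Lemma pi1_mul_hclass (x : X) (a b : pi1 R x) :
  pi1_mul a b = hclass_mul (a : hclass x x) b.
Proof. by []. Qed.

Lemma pi1_basepoint (x y : X) (p : {path I from y to x}) :
  mul_isomorphic (@pi1_mul R X x) (@pi1_mul R X y).
Proof.
pose d := hclass_of p; pose e := hclass_of (reverse_path p).
have de : hclass_mul d e = hclass_one y.
  by rewrite hclass_mulE; apply/hclass_eq; exact: concat_revr.
have ed : hclass_mul e d = hclass_one x.
  by rewrite hclass_mulE; apply/hclass_eq; exact: concat_revl.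
have edK z (a : hclass x z) : hclass_mul e (hclass_mul d a) = a.
  by rewrite -hclass_mulA ed hclass_mul1l.
have deK z (a : hclass y z) : hclass_mul d (hclass_mul e a) = a.
  by rewrite -hclass_mulA de hclass_mul1l.
exists (fun a : pi1 R x => hclass_mul d (hclass_mul (a : hclass x x) e) : pi1 R y).
  exists (fun b : pi1 R y => hclass_mul e (hclass_mul (b : hclass y y) d) : pi1 R x) => a.
    by rewrite !hclass_mulA ed hclass_mul1r edK.
  by rewrite !hclass_mulA de hclass_mul1r deK.
move=> a b; rewrite !pi1_mul_hclass.
by rewrite !hclass_mulA edK.
Qed.

End Groupoid.

Section PathConnected.
Variables (R : realType).
Local Notation I := (unit_interval R).

Lemma segment_path n (u w : 'rV[R]_n) :
  {p : {path I from u to w} | forall t, p t = u + ival t *: (w - u)}.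
Proof.
have c : continuous (fun t : I => u + ival t *: (w - u)).
  move=> t; apply: (@continuousD _ _ _ (fun=> u) (fun t : I => ival t *: (w - u)) t).
    exact: cst_continuous.
  apply: (@continuous_comp _ _ _ (@ival R) (fun r : R => r *: (w - u))).
    exact: ival_cts.
  exact: scalel_continuous.
have c0 : u + ival (zero : I) *: (w - u) = u by rewrite ival0 scale0r addr0.
have c1 : u + ival (one : I) *: (w - u) = w by rewrite ival1 scale1r addrC subrK.
by exists (mk_path c c0 c1).
Qed.

(** The set of points that a path joins to [x] is open and closed: a ball in the range of a chart is
    convex, so any two points of its preimage are joined by the image of a segment. *)
Lemma connected_manifold_path n (X : topologicalType) (A : set (chart R n X)) :
  (forall x, exists2 c, A c & cdom c x) -> connected [set: X] ->
  forall x y : X, inhabited {path I from x to y}.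
Proof.
move=> cA cX x y.
pose S := [set z | inhabited {path I from x to z}].
have ball_path (z : X) : exists2 U, nbhs z U & forall w w', U w -> U w' ->
    inhabited {path I from w to w'}.
  have [c _ cz] := cA z.
  have oc := @crange_open _ _ _ c.
  have /nbhs_ballP[e /= e0 ec] : nbhs (c z) (c @` cdom c).
    by apply: open_nbhs_nbhs; split => //; exists z.
  exists (cdom c `&` c @^-1` ball (c z) e).
    apply: filterI; first by apply: open_nbhs_nbhs; split => //; exact: cdom_open.
    by apply: (cmap_cts cz); exact: nbhsx_ballx.
  move=> w w' [cw wz] [cw' wz'].
  have [p pE] := segment_path (c w) (c w').
  have pb t : (c @` cdom c) (p t).
    apply: ec; rewrite pE; move: wz wz'; rewrite -!ball_normE /= => wz wz'.
    have /andP[t0 t1] := ivalP t.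
    have -> : c z - (c w + ival t *: (c w' - c w)) =
        (1 - ival t) *: (c z - c w) + ival t *: (c z - c w').
      by rewrite !scalerBl !scalerBr scale1r; apply/rowP => i; rewrite !mxE; ring.
    apply: le_lt_trans (ler_normD _ _) _; rewrite !normrZ.
    rewrite !ger0_norm ?subr_ge0//.
    (* Strictness is drawn from the second term of the convex combination, which needs t > 0. *)
    have [->|tn0] := eqVneq (ival t) 0.
      by rewrite subr0 mul1r mul0r addr0.
    have tt : 0 < ival t by rewrite lt_def tn0.
    have : ival t * `|c z - c w'| < ival t * e by rewrite ltr_pM2l.
    have : (1 - ival t) * `|c z - c w| <= (1 - ival t) * e.
      by rewrite ler_wpM2l ?subr_ge0// ltW.
    lra.
  constructor.
  refine (@mk_path I X w w' (cinv c \o p) _ _ _).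
  - move=> t; apply: continuous_comp; first exact: cts_fun.
    exact: cinv_cts (pb t).
  - by rewrite /= path_zero cmapK.
  - by rewrite /= path_one cmapK.
suff : S = [set: X] by move=> ST; have : S y by rewrite ST.
have S0 : S !=set0 by exists x; constructor; exact: const_path.
apply: cX => //.
- exists S; last by rewrite setTI.
  rewrite openE => z [p]; have [U Uz Up] := ball_path z.
  apply: (filterS _ Uz) => w Uw.
  by have [q] := Up z w (nbhs_singleton Uz) Uw; constructor; exact: (concat p q).
- exists S; last by rewrite setTI.
  rewrite -openC openE => z Sz; have [U Uz Up] := ball_path z.
  apply: (filterS _ Uz) => w Uw [p]; apply: Sz.
  by have [q] := Up w z Uw (nbhs_singleton Uz); constructor; exact: (concat p q).
Qed.

End PathConnected.

(** * Lifting of paths and homotopies *)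

Section CircleTrig.
Variable R : realType.
Implicit Types a b : R.

(** On the right half of the unit circle, atan (b / a) is the argument of (a, b). *)
Lemma cos_atan_div a b : 0 < a -> a ^+ 2 + b ^+ 2 = 1 -> cos (atan (b / a)) = a.
Proof.
move=> a0 ab; rewrite cos_atan.
have -> : 1 + (b / a) ^+ 2 = (a^-1) ^+ 2.
  have b2 : b ^+ 2 = 1 - a ^+ 2 by rewrite -ab addrC addKr.
  by rewrite expr_div_n b2; field; rewrite gt_eqF.
by rewrite sqrtr_sqr gtr0_norm ?invr_gt0// invrK.
Qed.

Lemma sin_atan_div a b : 0 < a -> a ^+ 2 + b ^+ 2 = 1 -> sin (atan (b / a)) = b.
Proof.
move=> a0 ab; have ca := cos_atan_div a0 ab.
have := atanK (b / a); rewrite /tan ca => /(congr1 ( *%R^~ a)).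
by rewrite !divfK ?gt_eqF.
Qed.

End CircleTrig.

(* The path r |-> (c (x, r), s (x, r)) on the unit circle turns, over each step
   of some length h that is uniform by compactness, by an angle in
   ]-pi/2, pi/2[, which atan recovers continuously from its cosine kappa and its
   sine sigma; theta is the sum of these angles. *)
Section AngleLift.
Variables (R : realType) (X : topologicalType) (c s : X * R -> R).
Hypotheses (cX : compact [set: X]) (cc : continuous c) (cs : continuous s).
Hypothesis cs1 : forall p, c p ^+ 2 + s p ^+ 2 = 1.
Hypotheses (c0 : forall x, c (x, 0) = 1) (s0 : forall x, s (x, 0) = 0).

Let kappa (p : X * R) (h : R) := c p * c (p.1, p.2 + h) + s p * s (p.1, p.2 + h).
Let sigma (p : X * R) (h : R) := s (p.1, p.2 + h) * c p - c (p.1, p.2 + h) * s p.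

Let shift_cts : continuous (fun ph : (X * R) * R => (ph.1.1, ph.1.2 + ph.2)).
Proof.
apply: pair_cts => ph.
  by apply: (@continuous_comp _ _ _ fst fst); exact: cvg_fst.
apply: (@continuousD _ _ _ (fun ph : (X * R) * R => ph.1.2) snd ph).
  by apply: (@continuous_comp _ _ _ fst snd); [exact: cvg_fst|exact: cvg_snd].
exact: cvg_snd.
Qed.

Let kappa_cts : continuous (fun ph : (X * R) * R => kappa ph.1 ph.2).
Proof.
move=> ph; apply: (@continuousD _ _ _
  (fun ph : (X * R) * R => c ph.1 * c (ph.1.1, ph.1.2 + ph.2))
  (fun ph : (X * R) * R => s ph.1 * s (ph.1.1, ph.1.2 + ph.2)) ph).
  apply: (@continuousM _ _ (fun ph : (X * R) * R => c ph.1)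
    (fun ph : (X * R) * R => c (ph.1.1, ph.1.2 + ph.2)) ph).
    by apply: (@continuous_comp _ _ _ fst c); [exact: cvg_fst|exact: cc].
  by apply: (@continuous_comp _ _ _ _ c); [exact: shift_cts|exact: cc].
apply: (@continuousM _ _ (fun ph : (X * R) * R => s ph.1)
  (fun ph : (X * R) * R => s (ph.1.1, ph.1.2 + ph.2)) ph).
  by apply: (@continuous_comp _ _ _ fst s); [exact: cvg_fst|exact: cs].
by apply: (@continuous_comp _ _ _ _ s); [exact: shift_cts|exact: cs].
Qed.

Let kappa_gt0 : \forall h \near (0 : R), forall x r, 0 <= r <= 1 -> 0 < kappa (x, r) h.
Proof.
(* At h = 0, [kappa] is 1, so it is positive near h = 0; compactness makes h uniform. As r + h may
   leave [0, 1], [c] and [s] are given for all real r. *)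
have K : compact ([set: X] `*` `[0, 1]%classic : set (X * R)%type).
  by apply: compact_setX => //; exact: segment_compact.
have kpos (p : X * R) : \forall p' \near p & h \near (0 : R), 0 < kappa p' h.
  have : 0 < kappa (p, 0 : R).1 (p, 0 : R).2.
    by case: p => x r; rewrite /kappa /= addr0 -!expr2 cs1 ltr01.
  move=> k0; exact: (kappa_cts (open_nbhs_nbhs (conj (@open_gt R 0) k0))).
have /compact_near_coveringP := K.
move=> /(_ R (nbhs (0 : R)) (fun h p => 0 < kappa p h) _ (fun p _ => kpos p)).
by apply: filterS => h hK x r r01; apply: hK; split => //=; rewrite in_itv.
Qed.

Lemma angle_lift : exists2 theta : X -> R, continuous theta &
  forall x, cos (theta x) = c (x, 1) /\ sin (theta x) = s (x, 1).
Proof.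
have /nbhs_ballP[e /= e0 eK] := kappa_gt0.
have [n] := ltr_add_invr e0; rewrite add0r.
set h := n.+1%:R^-1 => he.
have h0 : 0 < h by rewrite invr_gt0 ltr0n.
have nh : n.+1%:R * h = 1 by rewrite divff// pnatr_eq0.
have kh x r : 0 <= r <= 1 -> 0 < kappa (x, r) h.
  by apply: eK; rewrite /ball /= sub0r normrN gtr0_norm.
suff H k : (k <= n.+1)%N -> exists2 theta : X -> R, continuous theta &
    forall x, cos (theta x) = c (x, k%:R * h) /\ sin (theta x) = s (x, k%:R * h).
  by have := H n.+1 (leqnn _); rewrite nh.
elim: k => [_|k IH kn].
  exists (cst 0); first exact: cst_continuous.
  by move=> x; rewrite mul0r c0 s0 cos0 sin0.
have [theta ct tE] := IH (ltnW kn).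
have r01 : 0 <= k%:R * h <= 1.
  rewrite mulr_ge0 ?ler0n ?(ltW h0)//= -[leRHS]nh ler_pM2r// ler_nat.
  by apply: ltnW.
have kE : k.+1%:R * h = k%:R * h + h by rewrite -natr1 mulrDl mul1r.
pose p x := (x, k%:R * h) : X * R.
have pc : continuous p by apply: pair_cts => x; [exact: cvg_id|exact: cst_continuous].
pose p' x := (x, k.+1%:R * h) : X * R.
have pc' : continuous p' by apply: pair_cts => x; [exact: cvg_id|exact: cst_continuous].
(* As complex numbers, ka + i si is the quotient of c + i s at [p' x] by c + i s at [p x]. It has
   modulus 1, and adding its argument to [theta] multiplies back. *)
pose ka x := kappa (p x) h; pose si x := sigma (p x) h.
have kaE x : ka x = c (p x) * c (p' x) + s (p x) * s (p' x).
  by rewrite /ka /kappa /p /p' /= kE.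
have siE x : si x = s (p' x) * c (p x) - c (p' x) * s (p x).
  by rewrite /si /sigma /p /p' /= kE.
have ka0 x : 0 < ka x by exact: kh.
have ks1 x : ka x ^+ 2 + si x ^+ 2 = 1.
  transitivity ((c (p x) ^+ 2 + s (p x) ^+ 2) * (c (p' x) ^+ 2 + s (p' x) ^+ 2)).
    by rewrite kaE siE; ring.
  by rewrite !cs1 mulr1.
have ccp (f : X * R -> R) (q : X -> X * R) : continuous f -> continuous q ->
    forall x, {for x, continuous (fun x => f (q x))}.
  by move=> cf cq x; apply: (@continuous_comp _ _ _ q f); [exact: cq|exact: cf].
have kac x : {for x, continuous ka}.
  have -> : ka = (fun x => c (p x) * c (p' x) + s (p x) * s (p' x)) by apply/funext.
  by apply: continuousD; apply: continuousM; exact: ccp.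
have sic x : {for x, continuous si}.
  have -> : si = (fun x => s (p' x) * c (p x) - c (p' x) * s (p x)) by apply/funext.
  by apply: continuousB; apply: continuousM; exact: ccp.
exists (fun x => theta x + atan (si x / ka x)).
  move=> x.
  apply: (@continuousD _ _ _ theta (fun x => atan (si x / ka x)) x).
    exact: ct.
  apply: (@continuous_comp _ _ _ (fun x => si x / ka x) (@atan R));
    last exact: continuous_atan.
  apply: (@continuousM _ _ si (fun x => (ka x)^-1) x); first exact: sic.
  by apply: continuousV; [rewrite gt_eqF|exact: kac].
move=> x; have [ctx stx] := tE x; rewrite cosD sinD.
rewrite cos_atan_div// sin_atan_div// ctx stx -/(p x) -/(p' x) kaE siE.
have cs' := cs1 (p x).
split.
  transitivity (c (p' x) * (c (p x) ^+ 2 + s (p x) ^+ 2)); first by ring.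
  by rewrite cs' mulr1.
transitivity (s (p' x) * (c (p x) ^+ 2 + s (p x) ^+ 2)); first by ring.
by rewrite cs' mulr1.
Qed.

End AngleLift.

Section IntegerValued.
Variable R : realType.
Local Notation I := (unit_interval R).

Lemma unit_interval_image : [set: I] = @clamp R @` `[0, 1]%classic.
Proof.
apply/seteqP; split => // t _; exists (ival t); last exact: ivalK.
by rewrite /= in_itv /= ivalP.
Qed.

Lemma unit_interval_compact : compact [set: I].
Proof.
rewrite unit_interval_image; apply: continuous_compact; last exact: segment_compact.
by apply: continuous_subspaceT; exact: clamp_cts.
Qed.

Lemma integer_valued_constant (f : I -> R) : continuous f ->
  (forall t, exists k : int, f t = k%:~R) -> forall t t', f t = f t'.
Proof.
move=> cf fZ.
suff H t t' : ~ (f t < f t').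
  move=> t t'; apply/eqP; rewrite eq_le !leNgt.
  by apply/andP; split; apply/negP; exact: H.
move=> tt'.
have cI : connected (f @` (@clamp R @` `[0, 1]%classic)).
  apply: connected_continuous_connected; last by apply: continuous_subspaceT.
  apply: connected_continuous_connected; first exact: segment_connected.
  by apply: continuous_subspaceT; exact: clamp_cts.
move: cI; rewrite -unit_interval_image => /connected_intervalP iI.
have [k kE] := fZ t; have [k' k'E] := fZ t'.
(* The image is an interval, so it would contain k + 1/2, which is not an integer. *)
have kk' : k + 1 <= k' by move: tt'; rewrite kE k'E ltr_int lezD1.
have : (f @` [set: I]) (k%:~R + 2^-1).
  apply: (iI (f t) (f t')); [by exists t|by exists t'|].
  have : (k + 1)%:~R <= k'%:~R :> R by rewrite ler_int.
  by rewrite intrD kE k'E => ?; apply/andP; split; lra.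
move=> [r _]; have [l ->] := fZ r => lk.
have l1 : (k%:~R : R) < l%:~R by rewrite lk; lra.
have l2 : (l%:~R : R) < (k + 1)%:~R by rewrite lk intrD; lra.
by move: l1 l2; rewrite !ltr_int ltzD1 ltNge => /negbTE ->.
Qed.

(** This provides uniqueness of lifts: two lifts of one path to the plane differ by such a
    function. *)
Lemma lattice_valued_constant (f : I -> 'rV[R]_2) : continuous f ->
  (forall t, exists v, f t = Z2_to_R2 R v) -> forall t t', f t = f t'.
Proof.
move=> cf fZ t t'; apply/rowP => i.
apply: (@integer_valued_constant (fun t => f t ord0 i)).
  move=> r; apply: (@continuous_comp _ _ _ f (fun u : 'rV[R]_2 => u ord0 i)).
    exact: cf.
  exact: coord_continuous.
by move=> r; have [v ->] := fZ r; exists (v ord0 i); rewrite mxE.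
Qed.

Lemma Z2_to_R2_inj : injective (@Z2_to_R2 R).
Proof.
move=> v w /rowP vw; apply/rowP => i; have := vw i; rewrite !mxE.
exact: intr_inj.
Qed.

End IntegerValued.

Section Lifting.
Variables (R : realType) (F : topologicalType) (AF : set (chart R 2 F)).
Variables (rho : Z2action F).
Hypothesis srho : forall v, smooth AF AF (rho v).

Local Notation I := (unit_interval R).
Local Notation M := (flat_total R rho).
Local Notation pi := (@flat_pi R F rho).
Local Notation proj := (flat_proj R rho).

Lemma flat_pi_inj u x y : pi (u, x) = pi (u, y) -> x = y.
Proof.
have u0 : `|u - u| < 2^-1 by rewrite subrr normr0 invr_gt0 ltr0n.
by move=> /(flat_pi_near u0 u0)[].
Qed.

(** Over a given point of the plane the fiber component is unique, so it can be chosen pointwise;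
    continuity holds because [pi] is open, and injective over the cube around [L x]. *)
Lemma flat_lift_fiber (X : topologicalType) (G : X -> M) (L : X -> 'rV[R]_2) :
  continuous G -> continuous L -> (forall x, proj (G x) = torus_pi (L x)) ->
  exists2 y : X -> F, continuous y & forall x, G x = pi (L x, y x).
Proof.
move=> cG cL GL.
have /choice[y yE] x : exists y, G x = pi (L x, y) by exact: flat_cube (GL x).
exists y => // x B By.
have GN : nbhs (G x) (pi @` ([set z | `|z - L x| < 2^-1] `*` B)).
  rewrite yE; apply: open_map_nbhs; first exact: flat_pi_open srho.
  exists ([set z | `|z - L x| < 2^-1], B) => //; split => //=.
  by apply: nbhs_norm_sub; rewrite invr_gt0 ltr0n.
have LN : nbhs (L x) [set z | `|z - L x| < 2^-1].
  by apply: nbhs_norm_sub; rewrite invr_gt0 ltr0n.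
have GN' : nbhs x (G @^-1` (pi @` ([set z | `|z - L x| < 2^-1] `*` B))).
  exact: cG.
have LN' : nbhs x (L @^-1` [set z | `|z - L x| < 2^-1]) by exact: cL.
apply: filterS (filterI GN' LN') => x' [].
move=> [[z b] [/= zL Bb]] + /= xL; rewrite yE.
by move=> /(flat_pi_near zL xL)[_ <-].
Qed.

(* The contraction of the square to its corner, which turns a lifting problem
   on the square into that of AngleLift. *)
Let scale (p : I * I) (r : R) : I * I :=
  (clamp (r * ival p.1), clamp (r * ival p.2)).

Let scale_cts : continuous (fun pr : (I * I) * R => scale pr.1 pr.2).
Proof.
have H (g : I * I -> I) : continuous g ->
    continuous (fun pr : (I * I) * R => clamp (pr.2 * ival (g pr.1))).
  move=> cg pr; apply: (@continuous_comp _ _ _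
    (fun pr : (I * I) * R => pr.2 * ival (g pr.1)) (@clamp R)); last exact: clamp_cts.
  apply: (@continuousM _ _ snd (fun pr : (I * I) * R => ival (g pr.1)) pr).
    exact: cvg_snd.
  apply: (@continuous_comp _ _ _ fst (fun p : I * I => ival (g p))).
    exact: cvg_fst.
  by apply: (@continuous_comp _ _ _ g (@ival R)); [exact: cg|exact: ival_cts].
by apply: pair_cts; apply: H => p; [exact: cvg_fst|exact: cvg_snd].
Qed.

Lemma square_lift (G : I * I -> M) : continuous G ->
  proj (G (zero, zero)) = torus_pi 0 ->
  exists (L : I * I -> 'rV[R]_2) (y : I * I -> F),
    [/\ continuous L, continuous y, L (zero, zero) = 0 &
        forall p, G p = pi (L p, y p)].
Proof.
move=> cG G0.
have kX : compact [set: I * I].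
  rewrite -setXTT; apply: compact_setX; exact: unit_interval_compact.
have cproj : continuous proj by exact: flat_proj_continuous srho.
(* [H f] follows [f] along the ray from the corner, at r = 0, to the point, at r = 1. All rays start
   over [torus_pi 0], where the cosines are 1 and the sines 0, as [angle_lift] requires. *)
pose H (f : torus R -> R) (pr : (I * I) * R) := f (proj (G (scale pr.1 pr.2))).
have cH f : continuous f -> continuous (H f).
  move=> cf pr; apply: (@continuous_comp _ _ _
    (fun pr : (I * I) * R => scale pr.1 pr.2) (f \o proj \o G)).
    exact: scale_cts.
  apply: (@continuous_comp _ _ _ G (f \o proj)); first exact: cG.
  by apply: (@continuous_comp _ _ _ proj f); [exact: cproj|exact: cf].
have H0 f p : H f (p, 0) = f (torus_pi 0).
  by rewrite /H /scale /= !mul0r; congr f.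
have H1 f p : H f (p, 1) = f (proj (G p)).
  by rewrite /H /scale /= !mul1r !ivalK; case: p.
have angle i : exists2 theta : I * I -> R, continuous theta &
    forall p, cos (theta p) = torus_cos i (proj (G p)) /\
      sin (theta p) = torus_sin i (proj (G p)).
  have [|||p|p|p|theta ct tE] :=
    @angle_lift R (I * I)%type (H (torus_cos i)) (H (torus_sin i)).
  - exact: kX.
  - by apply: cH; exact: torus_cos_continuous.
  - by apply: cH; exact: torus_sin_continuous.
  - rewrite /H /torus_cos /torus_sin; exact: cos2Dsin2.
  - by rewrite H0 torus_cosE mxE mul0r cos0.
  - by rewrite H0 torus_sinE mxE mul0r sin0.
  by exists theta => // p; have := tE p; rewrite !H1.
have /choice[theta tE] i : exists theta : I * I -> R, continuous theta /\
    forall p, cos (theta p) = torus_cos i (proj (G p)) /\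
      sin (theta p) = torus_sin i (proj (G p)).
  by have [theta ? ?] := angle i; exists theta.
have pi2 : trigo.pi *+ 2 != 0 :> R by rewrite mulrn_eq0/= gt_eqF// pi_gt0.
pose L0 p := \row_i (theta i p / (trigo.pi *+ 2)) : 'rV[R]_2.
have cL0 : continuous L0.
  move=> p; apply: rV_for_continuous => i.
  have -> : (fun p => L0 p ord0 i) = (fun p => theta i p * (trigo.pi *+ 2)^-1).
    by apply/funext => q; rewrite mxE.
  apply: (@continuousM _ _ (theta i) (fun=> (trigo.pi *+ 2)^-1) p).
    exact: (tE i).1.
  exact: cst_continuous.
have L0E p : torus_pi (L0 p) = proj (G p).
  have [u uE] : exists u, proj (G p) = torus_pi u.
    by exists (orbit_repr (proj (G p))); apply/esym; exact: orbit_piK.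
  rewrite uE; apply: torus_pi_eq_trig => i; have [ce se] := (tE i).2 p.
    by rewrite mxE divfK// ce uE torus_cosE.
  by rewrite mxE divfK// se uE torus_sinE.
(* At the corner the angles are known only up to multiples of 2 pi, so a lattice translation
   normalizes the lift to 0 there. *)
have /orbit_piP[v vE] : torus_pi (L0 (zero, zero)) = torus_pi 0 by rewrite L0E.
have vL : Z2_to_R2 R v = - L0 (zero, zero).
  by apply/eqP; rewrite -addr_eq0 addrC; exact/eqP.
pose L p := translate v (L0 p).
have cL : continuous L.
  move=> p; apply: (@continuous_comp _ _ _ L0 (@translate R v)); first exact: cL0.
  exact: translate_continuous.
have LE p : proj (G p) = torus_pi (L p).
  by rewrite -L0E; apply/esym; exact: orbit_pi_act.
have [y cy yE] := flat_lift_fiber cG cL LE.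
by exists L, y; split => //; rewrite /L /translate vL subrr.
Qed.

End Lifting.

(** * The fundamental group of the total space *)

Section FlatPi1.
Variables (R : realType) (F : topologicalType) (AF : set (chart R 2 F)).
Variables (rho : Z2action F) (x0 : F).
Hypothesis srho : forall v, smooth AF AF (rho v).
Hypothesis rho_x0 : forall v, rho v x0 = x0.

Local Notation I := (unit_interval R).
Local Notation M := (flat_total R rho).
Local Notation pi := (@flat_pi R F rho).
Local Notation proj := (flat_proj R rho).
Local Notation Z := (@Z2_to_R2 R).
Local Notation m0 := (pi (0, x0)).

Lemma flat_pi_base v : pi (Z v, x0) = m0.
Proof. by apply/esym/flat_piP; exists v; rewrite add0r rho_x0. Qed.

Section FlatPath.
Variables (p : {path I from x0 to x0}) (v : 'rV[int]_2).

Let f (t : I) : M := pi (ival t *: Z v, p t).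

Let line_cts : continuous (fun t : I => ival t *: Z v).
Proof.
move=> t; apply: (@continuous_comp _ _ _ (@ival R) (fun r : R => r *: Z v)).
  exact: ival_cts.
exact: scalel_continuous.
Qed.

Let f_cts : continuous f.
Proof.
move=> t; apply: (@continuous_comp _ _ _ (fun t => (ival t *: Z v, p t)) pi).
  by apply: pair_for_continuous; [exact: line_cts|exact: cts_fun].
exact: flat_pi_continuous.
Qed.

Let f_zero : f zero = m0.
Proof. by rewrite /f ival0 scale0r path_zero. Qed.

Let f_one : f one = m0.
Proof. by rewrite /f ival1 scale1r path_one flat_pi_base. Qed.

Definition flat_path : {path I from m0 to m0} := mk_path f_cts f_zero f_one.

Lemma flat_pathE t : flat_path t = pi (ival t *: Z v, p t).
Proof. by []. Qed.

(** Only the component in the plane moves, along straight lines that fix its ends. *)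
Lemma flat_path_straighten (u : I -> 'rV[R]_2) (q : {path I from m0 to m0}) :
  continuous u -> u zero = 0 -> u one = Z v ->
  (forall t, q t = pi (u t, p t)) -> path_homotopic q flat_path.
Proof.
move=> cu u0 u1 qE; apply/asboolP.
exists (fun ts => pi (u ts.1 + ival ts.2 *: (ival ts.1 *: Z v - u ts.1), p ts.1)).
split.
- move=> ts; apply: (@continuous_comp _ _ _ (fun ts : I * I =>
    (u ts.1 + ival ts.2 *: (ival ts.1 *: Z v - u ts.1), p ts.1)) pi);
    last exact: flat_pi_continuous.
  have c1 (Y : topologicalType) (g : I -> Y) : continuous g ->
      {for ts, continuous (fun ts : I * I => g ts.1)}.
    by move=> cg; apply: (@continuous_comp _ _ _ fst g); [exact: cvg_fst|exact: cg].
  apply: pair_for_continuous; last by apply: c1; exact: cts_fun.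
  apply: (@continuousD _ _ _ (fun ts : I * I => u ts.1)); first exact: (c1 _ u cu).
  apply: (@continuousZ _ _ _ (fun ts : I * I => ival ts.2)
    (fun ts : I * I => ival ts.1 *: Z v - u ts.1) ts).
    by apply: (@continuous_comp _ _ _ snd (@ival R)); [exact: cvg_snd|exact: ival_cts].
  apply: (@continuousB _ _ _ (fun ts : I * I => ival ts.1 *: Z v)
    (fun ts : I * I => u ts.1) ts).
    exact: (c1 _ (fun t => ival t *: Z v) line_cts).
  exact: (c1 _ u cu).
- move=> t /=; rewrite ival0 ival1 scale0r addr0 scale1r addrC subrK.
  by rewrite qE.
- move=> s /=; rewrite ival0 ival1 u0 u1 scale0r scale1r !subrr !scaler0 !addr0.
  by rewrite !path_zero !path_one flat_pi_base.
Qed.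

End FlatPath.

Lemma flat_path_homotopic (p q : {path I from x0 to x0}) v :
  path_homotopic p q -> path_homotopic (flat_path p v) (flat_path q v).
Proof.
move=> /asboolP[H [cH Hpq H0]]; apply/asboolP.
exists (fun ts => pi (ival ts.1 *: Z v, H ts)); split.
- move=> ts; apply: (@continuous_comp _ _ _ (fun ts : I * I =>
    (ival ts.1 *: Z v, H ts)) pi); last exact: flat_pi_continuous.
  apply: pair_for_continuous; last exact: cH.
  apply: (@continuous_comp _ _ _ (fun ts : I * I => ival ts.1) (fun r : R => r *: Z v)).
    by apply: (@continuous_comp _ _ _ fst (@ival R)); [exact: cvg_fst|exact: ival_cts].
  exact: scalel_continuous.
- by move=> t /=; have [-> ->] := Hpq t.
- move=> s /=; have [-> ->] := H0 s; rewrite ival0 ival1 scale0r scale1r.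
  by rewrite flat_pi_base.
Qed.

(** The homotopy is lifted to the plane times [F]; its component in [F] is the homotopy sought. *)
Lemma flat_path_inj (p q : {path I from x0 to x0}) v w :
  path_homotopic (flat_path p v) (flat_path q w) -> path_homotopic p q /\ v = w.
Proof.
move=> /asboolP[H [cH Hpq H0]].
have H00 : proj (H (zero, zero)) = torus_pi 0.
  by have [-> _] := H0 zero; rewrite flat_projE.
have [L [y [cL cy L0 HE]]] := square_lift srho cH H00.
have ct (s : I) : continuous (fun t : I => L (t, s)).
  move=> t; apply: (@continuous_comp _ _ _ (fun t => (t, s)) L); last exact: cL.
  by apply: pair_for_continuous; [exact: cvg_id|exact: cst_continuous].
have cs (t : I) : continuous (fun s : I => L (t, s)).
  move=> s; apply: (@continuous_comp _ _ _ (fun s => (t, s)) L); last exact: cL.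
  by apply: pair_for_continuous; [exact: cst_continuous|exact: cvg_id].
have cline k : continuous (fun t : I => ival t *: Z k).
  move=> t; apply: (@continuous_comp _ _ _ (@ival R) (fun r : R => r *: Z k)).
    exact: ival_cts.
  exact: scalel_continuous.
have lattice u z x k : pi (u, x) = pi (z, k) -> exists l, u - z = Z l.
  move=> /esym/flat_piP[l [<- _]]; exists l.
  by rewrite addrC addrA addNr add0r.
(* A lift from 0 of a loop [flat_path r k] differs from the segment by a continuous lattice-valued
   function that vanishes at the start, hence equals the segment. *)
have hor s k r : L (zero, s) = 0 -> (forall t, H (t, s) = flat_path r k t) ->
    forall t, L (t, s) = ival t *: Z k.
  move=> Ls Hr t; apply/eqP; rewrite -subr_eq0; apply/eqP.
  have := @lattice_valued_constant R (fun t => L (t, s) - ival t *: Z k) _ _ t zero.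
  rewrite Ls ival0 scale0r subrr; apply.
    move=> t'; apply: (@continuousB _ _ _ (fun t => L (t, s))
      (fun t : I => ival t *: Z k) t').
      exact: ct.
    exact: cline.
  move=> t'; apply: (lattice (L (t', s)) (ival t' *: Z k) (y (t', s)) (r t')).
  by rewrite -flat_pathE -Hr HE.
have hor' s k r : L (zero, s) = 0 -> (forall t, H (t, s) = flat_path r k t) ->
    forall t, y (t, s) = r t.
  move=> Ls Hr t; apply: (@flat_pi_inj R F rho (ival t *: Z k)).
  by rewrite -{1}(hor s k r Ls Hr t) -HE Hr.
(* This side of the square lifts the constant loop at [m0], so it stays at one lattice point. *)
have L0s s : L (zero, s) = 0.
  rewrite -L0; apply: (@lattice_valued_constant R (fun s => L (zero, s))).
    exact: cs.
  move=> s'; have [h _] := H0 s'; move: h; rewrite HE => /lattice[l].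
  by rewrite subr0 => ->; exists l.
have L10 : L (one, zero) = Z v.
  rewrite (hor zero v p (L0s _)); first by rewrite ival1 scale1r.
  by move=> t; have [] := Hpq t.
have L11 : L (one, one) = Z w.
  rewrite (hor one w q (L0s _)); first by rewrite ival1 scale1r.
  by move=> t; have [] := Hpq t.
(* The opposite side is constant for the same reason, and it joins [Z v] to [Z w]. *)
have L1s s : L (one, s) = Z v.
  rewrite -L10; apply: (@lattice_valued_constant R (fun s => L (one, s))).
    exact: cs.
  move=> s'; have [_ h] := H0 s'; move: h; rewrite HE => /lattice[l].
  by rewrite subr0 => ->; exists l.
split; last by apply: (@Z2_to_R2_inj R); rewrite -L11 L1s.
apply/asboolP; exists y; split; first exact: cy.
- move=> t; split.
    by apply: (hor' zero v p (L0s _)) => t'; have [] := Hpq t'.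
  by apply: (hor' one w q (L0s _)) => t'; have [] := Hpq t'.
- move=> s; have [h0 h1] := H0 s; split.
    by apply: (@flat_pi_inj R F rho 0); rewrite -h0 HE L0s.
  by apply: (@flat_pi_inj R F rho (Z v)); rewrite flat_pi_base -h1 HE L1s.
Qed.

Lemma flat_path_surj (q : {path I from m0 to m0}) :
  exists (p : {path I from x0 to x0}) v, path_homotopic q (flat_path p v).
Proof.
(* The loop is lifted as a square that is constant in the second variable. *)
have cq : continuous (fun ts : I * I => q ts.1).
  by move=> ts; apply: (@continuous_comp _ _ _ fst q); [exact: cvg_fst|exact: cts_fun].
have q00 : proj (q (zero, zero : I).1) = torus_pi 0.
  by rewrite /= path_zero flat_projE.
have [L [y [cL cy L0 qE]]] := square_lift srho cq q00.
have cdiag : continuous (fun t : I => (t, zero : I)).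
  by apply: pair_cts => t; [exact: cvg_id|exact: cst_continuous].
have cLt : continuous (fun t : I => L (t, zero)).
  move=> t; apply: (@continuous_comp _ _ _ (fun t : I => (t, zero : I)) L).
    exact: cdiag.
  exact: cL.
have cyt : continuous (fun t : I => y (t, zero)).
  move=> t; apply: (@continuous_comp _ _ _ (fun t : I => (t, zero : I)) y).
    exact: cdiag.
  exact: cy.
have y0 : y (zero, zero) = x0.
  by apply: (@flat_pi_inj R F rho 0); rewrite -{1}L0 -qE /= path_zero.
(* The lift ends in the orbit of (0, x0), and [x0] is fixed, so the component in [F] is again a
   loop. *)
have := qE (one, zero); rewrite /= path_one => /flat_piP[v [vL vy]].
have y1 : y (one, zero) = x0 by rewrite -vy rho_x0.
exists (mk_path cyt y0 y1), v.
apply: (@flat_path_straighten _ _ (fun t => L (t, zero))) => //.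
  by rewrite -vL add0r.
by move=> t; rewrite -qE.
Qed.

Lemma flat_path_concat (v w : 'rV[int]_2) (c : continuous (rho v))
    (p q : {path I from x0 to x0}) :
  path_homotopic (concat (flat_path p v) (flat_path q w))
    (flat_path (concat p (comp_path c (rho_x0 v) q)) (v + w)).
Proof.
(* The broken line from 0 to [Z v] to [Z (v + w)], written as a sum of two clamped motions, each at
   rest while the other runs; continuity then needs no gluing. *)
pose u (t : I) := ival (clamp (2 * ival t - 0) : I) *: Z v +
  ival (clamp (2 * ival t - 1) : I) *: Z w.
have cu : continuous u.
  have ck r k : continuous (fun t : I => ival (clamp (2 * ival t - r) : I) *: Z k).
    move=> t; apply: (@continuous_comp _ _ _
      (fun t : I => ival (clamp (2 * ival t - r) : I)) (fun r : R => r *: Z k)).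
      apply: (@continuous_comp _ _ _ (fun t : I => clamp (2 * ival t - r)) (@ival R)).
        exact: rescale_cts.
      exact: ival_cts.
    exact: scalel_continuous.
  move=> t; apply: (@continuousD _ _ _
    (fun t : I => ival (clamp (2 * ival t - 0) : I) *: Z v)).
    exact: ck.
  exact: ck.
have clamp0 : ival (clamp 0 : I) = 0 by rewrite ival_clamp_le//; lra.
have clamp1 : ival (clamp 1 : I) = 1 by rewrite ival_clamp_le//; lra.
apply: (@flat_path_straighten _ _ u) => //.
- rewrite /u ival0 !(@clamp_le0 R (_ - _)); [|lra..].
  by rewrite clamp0 !scale0r addr0.
- rewrite /u ival1 !(@clamp_ge1 R (_ - _)); [|lra..].
  by rewrite clamp1 !scale1r Z2_to_R2_D.
- move=> t; rewrite !concatE /u subr0; case: ifP => t2; rewrite flat_pathE.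
    rewrite [clamp (2 * ival t - 1)]clamp_le0; last by lra.
    by rewrite clamp0 scale0r addr0.
  move: t2 => /negbT; rewrite -ltNge => t2.
  rewrite [clamp (2 * ival t)]clamp_ge1; last by lra.
  (* Translating the lift of the second loop by [v] to start at [Z v] applies [rho v] to its
     component in [F]: this is the twist of the semidirect product. *)
  rewrite clamp1 scale1r; apply/flat_piP; exists v; split => //.
  exact: addrC.
Qed.

Lemma flat_pi1 (c : forall v, continuous (rho v)) :
  mul_isomorphic (@pi1_mul R M m0)
    (semidirect_mul (@pi1_mul R F x0) (fun v => pi1_map (c v) (rho_x0 v))).
Proof.
apply: mul_isomorphic_sym.
(* Inverse to lifting loops from (0, x0) to 'rV[R]_2 * F: a lift ends at
   (Z v, x0) since x0 is fixed. *)
pose Psi (a : pi1 R x0 * 'rV[int]_2) : pi1 R m0 :=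
  pi1_class (flat_path (pi1_repr a.1) a.2).
have Psi_inj a b : Psi a = Psi b -> a = b.
  move: a b => [a v] [b w] /hclass_eq/flat_path_inj[/= ab vw].
  congr (_, _); last exact: vw.
  by rewrite -[a]hclass_reprK -[b]hclass_reprK; apply/hclass_eq.
have /choice[g gK] (d : pi1 R m0) : exists a, Psi a = d.
  have [p [v pv]] := flat_path_surj (pi1_repr d).
  exists (pi1_class p, v); rewrite -[d]hclass_reprK; apply/hclass_eq.
  apply: (@path_homotopic_trans _ _ _ _ (flat_path p v)).
    by apply: flat_path_homotopic; exact: hclass_reprP.
  by rewrite path_homotopic_sym.
exists Psi; first by exists g => // a; apply: Psi_inj; rewrite gK.
move=> [a v] [b w]; apply: etrans _ (esym (hclass_mulE _ _)); apply/hclass_eq.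
rewrite path_homotopic_sym.
apply: (path_homotopic_trans (flat_path_concat w (c v) (pi1_repr a) (pi1_repr b))).
apply: flat_path_homotopic; rewrite path_homotopic_sym.
apply: (path_homotopic_trans (hclass_reprP _)).
apply: concat_homotopic; first exact: path_homotopic_refl.
exact: hclass_reprP.
Qed.

End FlatPi1.

Lemma flat_path_connected (R : realType) (F : topologicalType)
    (AF : set (chart R 2 F)) (rho : Z2action F) :
  closed_manifold AF -> connected [set: F] ->
  forall m m' : flat_total R rho, inhabited {path unit_interval R from m to m'}.
Proof.
move=> F_closed cF m m'.
have [[u x] <-] := flat_pi_surj m; have [[w y] <-] := flat_pi_surj m'.
have cover z : exists2 b, AF b & cdom b z.
  by case: F_closed => -[_ _ [cAF _]] _; exact: cAF.
have [p] := connected_manifold_path cover cF x y.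
have [q _] := segment_path u w.
constructor.
refine (@mk_path _ _ _ _ (fun t => flat_pi rho (q t, p t)) _ _ _).
- move=> t; apply: (@continuous_comp _ _ _ (fun t => (q t, p t)) (flat_pi rho)).
    by apply: pair_for_continuous; exact: cts_fun.
  exact: flat_pi_continuous.
- by rewrite !path_zero.
- by rewrite !path_one.
Qed.

Local Close Scope quotient_scope.

Theorem theorem4 (R : realType) (F : topologicalType) (AF : set (chart R 2 F))
    (F_closed : closed_manifold AF) (F_connected : connected [set: F])
    (rho : Z2action F)
    (rho_smooth : forall v, diffeomorphism AF AF (rho v))
    (x0 : F) (rho_x0 : forall v, rho v x0 = x0) :
  let rho_star (v : 'rV[int]_2) : pi1 R x0 -> pi1 R x0 :=
    pi1_map (diffeomorphism_continuous (rho_smooth v)) (rho_x0 v) in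
  (exists (M : topologicalType) (A : set (chart R 4 M))
     (K : set M) (f : M -> torus R),
     surface_collapse AF A K f /\
     forall m : M, mul_isomorphic (@pi1_mul R M m)
       (semidirect_mul (@pi1_mul R F x0) rho_star))
  /\
  (exists (K : set (flat_total R rho)) (f : flat_total R rho -> torus R),
     [/\ surface_collapse AF (flat_atlas rho AF) K f,
       forall m : flat_total R rho, mul_isomorphic (@pi1_mul R _ m)
         (semidirect_mul (@pi1_mul R F x0) rho_star)
     & exists (D : set (torus R)) (b : torus R),
       [/\ closed_disk (torus_atlas R) D, interior D b,
         trivialized_over (flat_atlas rho AF) (torus_atlas R) AF
           (flat_proj R rho) D
       & forall e, ~ D (flat_proj R rho e) -> f e = flat_proj R rho e]]).
Proof.
move=> rho_star.
have srho v : smooth AF AF (rho v) by have [] := rho_smooth v.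
have pi1_flat m : mul_isomorphic (@pi1_mul R (flat_total R rho) m)
    (semidirect_mul (@pi1_mul R F x0) rho_star).
  have [p] := flat_path_connected F_closed F_connected (@flat_pi R F rho (0, x0)) m.
  exact: mul_isomorphic_trans (pi1_basepoint p) (flat_pi1 srho rho_x0 _).
have collapse := flat_collapse srho F_closed x0.
split.
  by exists (flat_total R rho), (flat_atlas rho AF), (@zero_fiber R F rho), (flat_proj R rho).
(* The map is the projection everywhere, so only a disk and a trivialization over it are still to be
   produced. *)
exists (@zero_fiber R F rho), (flat_proj R rho); split => //.
have [D [b [dD Db Dc]]] := torus_disk R.
by exists D, b; split => //; exact: flat_trivialized.
Qed.
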